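(* Let $n\ge 1$, let $a\in\mathbb C$, let $D\in\mathbb C^{n\times n}$ be a diagonal matrix and let $P$ be an $n\times n$ permutation matrix. If $M=aI+DP$ or $M=aI+PD$, then for every polynomial $p$ with complex coefficients, $$\|p(M)\|\le 2\max_{z\in W(M)}|p(z)|.$$
   Context: For a square complex matrix $M$, $W(M)=\{x^*Mx : x^*x=1\}$ is the numerical range, and $\|\cdot\|$ is the operator 2-norm (largest singular value). *)

(* Defs.v *)
From mathcomp Require Import all_boot all_order all_algebra.
From mathcomp Require Import complex.
From mathcomp Require Import boolp classical_sets reals.

Set Implicit Arguments.
Unset Strict Implicit.
Unset Printing Implicit Defensive.

Import Order.TTheory GRing.Theory Num.Theory.
Local Open Scope classical_set_scope.
Local Open Scope ring_scope.
Local Open Scope complex_scope.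
Local Open Scope sesquilinear_scope.

(* The complex numbers are R[i] for R : realType; Normc.normc : R[i] -> R is
   the modulus. *)

Definition norm2 (R : realType) (n : nat) (x : 'cV[R[i]]_n) : R :=
  Num.sqrt (\sum_i Normc.normc (x i 0) ^+ 2).

(* [sup] is 0 on sets that are empty or unbounded; [opnorm2_has_sup] below
   shows that this default is not reached when n > 0. *)
Definition opnorm2 (R : realType) (m n : nat) (A : 'M[R[i]]_(m, n)) : R :=
  sup [set norm2 (A *m x) | x in [set x : 'cV[R[i]]_n | norm2 x = 1]].

Definition numrange (R : realType) (n : nat) (M : 'M[R[i]]_n) : set R[i] :=
  [set (x ^t* *m M *m x) 0 0 | x in [set x : 'cV[R[i]]_n | x ^t* *m x = 1%:M]].

Lemma normc_ge0 (R : realType) (z : R[i]) : 0 <= Normc.normc z.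
Proof. by case: z => a b; apply: sqrtr_ge0. Qed.

Lemma normc_sum (R : realType) (I : Type) (r : seq I) (F : I -> R[i]) :
  Normc.normc (\sum_(i <- r) F i) <= \sum_(i <- r) Normc.normc (F i).
Proof.
elim: r => [|i r IH]; first by rewrite !big_nil Normc.normc0.
by rewrite !big_cons (le_trans (le_normcD _ _)) // lerD2l.
Qed.

Lemma opnorm2_has_sup (R : realType) (m n : nat) (A : 'M[R[i]]_(m, n.+1)) :
  has_sup [set norm2 (A *m x) | x in [set x : 'cV[R[i]]_n.+1 | norm2 x = 1]].
Proof.
split.
  exists (norm2 (A *m delta_mx 0 0)), (delta_mx 0 0) => //=.
  rewrite /norm2 big_ord_recl big1 ?addr0 => [|i _]; rewrite !mxE /=.
    by rewrite expr0n addr0 expr1n sqrtr1 expr1n sqrtr1.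
  by rewrite expr0n addr0 sqrtr0 expr0n.
exists (Num.sqrt (\sum_i (\sum_j Normc.normc (A i j)) ^+ 2)) => _ [x /= x1 <-].
rewrite ler_wsqrtr // ler_sum // => i _.
rewrite lerXn2r ?nnegrE ?normc_ge0 ?sumr_ge0 // => [j _|]; first exact: normc_ge0.
rewrite mxE (le_trans (normc_sum _ _)) // ler_sum // => j _.
rewrite Normc.normcM ler_piMr ?normc_ge0 //.
rewrite -x1 /norm2 -[leLHS]ger0_norm ?normc_ge0 // -sqrtr_sqr ler_wsqrtr //.
by rewrite (bigD1 j) //= lerDl sumr_ge0 // => k _; apply: sqr_ge0.
Qed.

(* Main.v *)
Require Import Defs.
From mathcomp Require Import all_boot all_order all_algebra all_fingroup.
From mathcomp Require Import complex.
From mathcomp Require Import boolp classical_sets reals.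
From mathcomp Require Import topology normedtype trigo exp realfun.
From mathcomp Require Import ring lra zify.

Import Order.TTheory GRing.Theory Num.Theory.
Import numFieldNormedType.Exports Normc.
Local Open Scope ring_scope.
Local Open Scope complex_scope.

(* After subtracting a and splitting P into cycles, M becomes a direct sum of
   cyclic weighted shifts C of sizes m = n + 1, each of whose numerical ranges
   lies in W(M), so one cycle may be treated at a time. Let r be the geometric
   mean of the moduli of the weights.

   If every product of j < m consecutive weights has modulus at most 2 r^j, a
   diagonal similarity with condition number at most 2 turns C into a scalar
   multiple of a unitary matrix whose eigenvalues are eigenvalues of C.

   Otherwise let N > r be the largest (|w_k ... w_(k+j-1)| / 2)^(1/j). All
   consecutive products of T = C / N have modulus at most 2, so T is a
   contraction for a weighted Hilbert norm within a factor 2 of the given one,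
   and |q(T)| <= 2 max |q| over the unit circle by von Neumann's inequality. It
   remains to write C = g(T) with g polynomial and g(z) in W(C) for |z| = 1.
   If the maximising run leaves out at least two edges, AM-GM produces the disc
   of radius N in W(C), and g = N z works. If it leaves out exactly one edge,
   W(C) contains the hypotrochoid N (e + b conj(e)^n) for |e| = 1, where
   T^m = 4 n b, and one takes g = N z (1 - 4 n |b|^2 + conj(b) z^m): the linear
   coefficient is exactly what g(T) = C requires, and the curve g(|z| = 1) stays
   inside the star-shaped hull of the hypotrochoid. *)

(** * Moduli, conjugates and chords in [R[i]] *)

Section ComplexScalars.
Context {R : realType}.
Implicit Types z w : R[i].
Local Notation C := R[i].
Local Notation conj := (@conjc R).

Lemma sqr_normcE z : normc z ^+ 2 = complex.Re z ^+ 2 + complex.Im z ^+ 2.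
Proof. by case: z => a b; rewrite sqr_sqrtr // addr_ge0 ?sqr_ge0. Qed.

Lemma conjcD z w : conj (z + w) = conj z + conj w.
Proof. exact: rmorphD. Qed.

Lemma conjcB z w : conj (z - w) = conj z - conj w.
Proof. exact: rmorphB. Qed.

Lemma conjcM z w : conj (z * w) = conj z * conj w.
Proof. exact: rmorphM. Qed.

Lemma conjcX z n : conj (z ^+ n) = conj z ^+ n.
Proof. exact: rmorphXn. Qed.

Lemma conjc_mul_norm z : conj z * z = (normc z ^+ 2)%:C.
Proof.
rewrite sqr_normcE; case: z => a b /=.
by apply/eqP; rewrite eq_complex /=; apply/andP; split; apply/eqP; ring.
Qed.

Lemma normc_conj z : normc (conj z) = normc z.
Proof. by case: z => a b /=; rewrite sqrrN. Qed.

Lemma normc_gt0 z : z != 0 -> 0 < normc z.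
Proof.
move=> z0; rewrite lt_neqAle normc_ge0 andbT eq_sym.
by apply: contraNneq z0 => /eq0_normc ->.
Qed.

Lemma normc_real (x : R) : normc x%:C = `|x|.
Proof. by rewrite /= expr0n addr0 sqrtr_sqr. Qed.

Lemma normcX z n : normc (z ^+ n) = normc z ^+ n.
Proof.
elim: n => [|n IH]; first by rewrite !expr0 normc1.
by rewrite !exprS normcM IH.
Qed.

Lemma normc_prod (I : Type) (r : seq I) (F : I -> C) :
  normc (\prod_(i <- r) F i) = \prod_(i <- r) normc (F i).
Proof.
elim: r => [|i r IH]; first by rewrite !big_nil normc1.
by rewrite !big_cons normcM IH.
Qed.

Lemma sqr_normcD z w : normc (z + w) ^+ 2 =
  normc z ^+ 2 + normc w ^+ 2 + 2 * complex.Re (conj z * w).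
Proof. by rewrite !sqr_normcE; case: z w => a b [c d] /=; ring. Qed.

Lemma Re_le_normc z : complex.Re z <= normc z.
Proof.
have := sqr_normcE z; have := normc_ge0 z; case: z => a b /= ? ?.
by rewrite (le_trans (ler_norm _)) // -sqrtr_sqr ler_wsqrtr // lerDl sqr_ge0.
Qed.

Lemma normc_sub1X_le z n : normc z = 1 ->
  normc (1 - z ^+ n) <= n%:R * normc (1 - z).
Proof.
move=> z1; rewrite -{1}(expr1n _ n) subrXX normcM mulrC.
rewrite ler_wpM2r ?normc_ge0 // (le_trans (normc_sum _ _)) //.
rewrite (eq_bigr (fun=> 1)) ?sumr_const ?card_ord // => i _.
by rewrite expr1n mul1r normcX z1 expr1n.
Qed.

(* Chord against sine: |1 - K|^2 = 2 - 2 Re K, and Re K >= 1 - (Im K)^2. *)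
Lemma unit_chord_le (K : C) (a k : R) : normc K = 1 -> 0 <= complex.Re K ->
  0 <= a -> 0 <= k -> `|complex.Im K| <= a -> a < 1 ->
  2 * a ^+ 2 <= (2 - a ^+ 2) * k ^+ 2 -> normc (1 - K) <= k.
Proof.
move=> K1 K0 a0 k0 Ka a1 ak.
rewrite -(@ler_pXn2r _ 2) ?nnegrE ?normc_ge0 //.
have := sqr_normcE K; rewrite K1 expr1n sqr_normcE.
case: K K1 K0 Ka => x y /= _ x0 ya e.
have ya2 : y ^+ 2 <= a ^+ 2 by rewrite -(real_normK (num_real y)) ler_pXn2r ?nnegrE.
nra.
Qed.

End ComplexScalars.

(** * Star-shaped hulls of ellipses and hypotrochoids *)

Section BoundaryCurve.
Context {R : realType}.
Local Notation C := R[i].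
Local Notation conj := (@conjc R).

(* For a cycle of length 2 the curve E + conj b conj E is an ellipse, and
   |E| <= 1 holds because the difference of the squares of its two sides is a
   positive multiple of 8 (Re b - |b|^2)^2 (1 + Re b - 2 |b|^2). *)
Lemma ellipse_cover (b : C) : normc b <= 4^-1 ->
  exists2 E : C, normc E <= 1 &
    1 - 4 * (normc b ^+ 2)%:C + b = E + conj b * conj E.
Proof.
move=> hb; set B := normc b ^+ 2.
have B16 : B <= 16^-1 by have := normc_ge0 b; rewrite /B; nra.
have B0 : 0 <= B by apply: sqr_ge0.
have hx : `|complex.Re b| <= 4^-1.
  apply: le_trans hb; rewrite -(@ler_pXn2r _ 2) ?nnegrE ?normc_ge0 //.
  by rewrite real_normK ?num_real // sqr_normcE lerDl sqr_ge0.
have eB : B = complex.Re b ^+ 2 + complex.Im b ^+ 2 by exact: sqr_normcE.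
have dp : 0 < 1 - B by lra.
have eD : 1 - B%:C = (1 - B)%:C :> C by rewrite rmorphB rmorph1.
have d0 : (1 - B%:C : C) != 0 by rewrite eD fmorph_eq0 gt_eqF.
set Q := 1 - 4 * B%:C + b.
(* Eliminating [conj E] between the equation and its conjugate gives this [E]. *)
exists ((Q - conj b * conj Q) / (1 - B%:C)).
  rewrite normcM normcV eD normc_real gtr0_norm // ler_pdivrMr // mul1r.
  rewrite -(@ler_pXn2r _ 2) ?nnegrE ?normc_ge0 ?(ltW dp) // -subr_ge0.
  have -> : (1 - B) ^+ 2 - normc (Q - conj b * conj Q) ^+ 2 =
      8 * (complex.Re b - B) ^+ 2 * (1 + complex.Re b - 2 * B).
    rewrite sqr_normcE /Q eB.
    by case: (b) => x y /=; ring.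
  apply: mulr_ge0; first by rewrite mulr_ge0 ?sqr_ge0.
  by move: hx; rewrite ler_norml => /andP[h1 h2]; lra.
rewrite conjcM conjc_inv eD conjc_real -eD conjcB conjcM !conjcK.
rewrite mulrA -mulrDl; apply: canRL (mulfK d0) _.
rewrite mulrBr mulrBr [conj b * (b * Q)]mulrA conjc_mul_norm -/B.
by ring.
Qed.

Lemma cisX (t : R) k : (cos t +i* sin t)%C ^+ k =
  (cos (k%:R * t) +i* sin (k%:R * t))%C.
Proof.
elim: k => [|k IH]; first by rewrite mul0r cos0 sin0.
rewrite exprS IH -natr1 mulrDl mul1r addrC cosD sinD.
by apply/eqP; rewrite eq_complex /=; apply/andP; split; apply/eqP; ring.
Qed.

(** Intermediate values for [K = cis t] on [[-pi/2, pi/2]]: the sine is -1 and 1 at the ends, and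
    the term in [g] has modulus below 1, so the imaginary part changes sign. *)
Lemma unit_real_value (g : C) k : normc g < 1 ->
  exists K : C, [/\ normc K = 1, 0 <= complex.Re K &
    complex.Im (K + g * conj K ^+ k) = 0].
Proof.
move=> g1.
pose cis (t : R) : C := (cos t +i* sin t)%C.
have cis1 t : normc (cis t) = 1 by rewrite /= cos2Dsin2 sqrtr1.
pose f (t : R) := sin t + (complex.Im g * cos (k%:R * t)
                           - complex.Re g * sin (k%:R * t)).
have fE t : complex.Im (cis t + g * conj (cis t) ^+ k) = f t.
  by rewrite -rmorphXn /= cisX /f; case: (g) => u v /=; ring.
have fb t : `|f t - sin t| <= normc g.
  have -> : f t - sin t = complex.Im (g * conj (cis t) ^+ k).
    by rewrite -fE raddfD /= addrAC subrr add0r.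
  set w := _ * _.
  have <- : normc w = normc g by rewrite normcM normcX normc_conj cis1 expr1n mulr1.
  rewrite -(@ler_pXn2r _ 2) ?nnegrE ?normc_ge0 //.
  by rewrite real_normK ?num_real // sqr_normcE lerDr sqr_ge0.
have cf : continuous f.
  move=> t; apply: cvgD; first exact: continuous_sin.
  have kc : {for t, continuous (fun x : R => k%:R * x)}.
    by apply: cvgM; [exact: cvg_cst | exact: cvg_id].
  apply: cvgB; apply: cvgM; try exact: cvg_cst.
    exact: (continuous_comp kc (@continuous_cos _ _)).
  exact: (continuous_comp kc (@continuous_sin _ _)).
have pi0 : 0 <= pi / 2 :> R by rewrite divr_ge0 ?pi_ge0.
have [|||t tI ft] := @IVT R f (- (pi / 2)) (pi / 2) 0.
- lra.
- by apply: continuous_subspaceT.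
- have := fb (pi / 2); have := fb (- (pi / 2)).
  rewrite sinN sin_pihalf !ler_norml => /andP[_ h1] /andP[h2 _].
  by rewrite ge_min le_max; apply/andP; split; apply/orP; [left|right]; lra.
exists (cis t); split; [exact: cis1| |by rewrite fE].
by apply: cos_ge0_pihalf; move: tI; rewrite in_itv.
Qed.

(** Write the left side as [q H] with [|H| = 1]. Some [E = H K] puts the curve point on the ray of
    [H], at distance [rho], and it remains to show [q <= rho]. As [E] is within [13/6 |b|] of 1, the
    loss from replacing [b] by [b E^(k+1)] in [rho^2] is paid for by the subtracted [c] in [q]. *)
Lemma hypotrochoid_cover (b : C) k : (2 <= k)%N ->
  normc b <= (4 * k%:R)^-1 ->
  exists E : C, exists s : R, [/\ normc E = 1, 0 <= s <= 1 &
    1 - (4 * k%:R * normc b ^+ 2)%:C + b = s%:C * (E + conj b * conj E ^+ k)].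
Proof.
move=> k2 hb; set B := normc b; set c := 4 * k%:R * B ^+ 2.
have K2 : 2 <= k%:R :> R by rewrite ler_nat.
have B0 : 0 <= B by exact: normc_ge0.
have kB : 4 * k%:R * B <= 1.
  by rewrite mulrC -ler_pdivlMr ?mul1r //; lra.
have B8 : B <= 8^-1 by nra.
have cB : c <= B by rewrite /c expr2 mulrA ler_piMl.
have c0 : 0 <= c by rewrite /c mulr_ge0 ?sqr_ge0 //; lra.
set Q := 1 - c%:C + b.
set q := normc Q.
have ReB : `|complex.Re b| <= B.
  rewrite -(@ler_pXn2r _ 2) ?nnegrE //.
  by rewrite real_normK ?num_real // sqr_normcE lerDl sqr_ge0.
have q2 : q ^+ 2 = (1 - c) ^+ 2 + B ^+ 2 + 2 * (1 - c) * complex.Re b.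
  by rewrite /q /B !sqr_normcE /Q; case: (b) => x y /=; ring.
have q0 : 0 < q.
  rewrite lt_neqAle normc_ge0 andbT eq_sym; apply/negP => /eqP e.
  move: q2 ReB; rewrite e ler_norml expr0n /= => q2 /andP[h1 h2].
  have : 0 < (1 - c - B) ^+ 2 by apply: exprn_gt0; lra.
  nra.
have qC0 : q%:C != 0 :> C by rewrite fmorph_eq0 gt_eqF.
pose H := Q / q%:C.
have H1 : normc H = 1 by rewrite normcM normcV normc_real gtr0_norm // mulfV ?gt_eqF.
have QH : Q = q%:C * H by rewrite /H mulrCA mulfV // mulr1.
have dH : normc (1 - H) <= 29 / 25 * B.
  (* [|Im H|] is at most [B / (1 - c)], and [c <= B <= 1/8] gives the factor [8/7]. *)
  apply: (@unit_chord_le _ _ (8 / 7 * B)) => //; try lra.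
  - have -> : complex.Re H = (1 - c + complex.Re b) / q.
      rewrite /H -fmorphV /Q; case: (b) => x y /=; field; rewrite gt_eqF //.
    rewrite divr_ge0 ?(ltW q0) //; move: ReB; rewrite ler_norml => /andP[h1 h2].
    lra.
  - have -> : complex.Im H = complex.Im b / q.
      rewrite /H -fmorphV /Q; case: (b) => x y /=; field; rewrite gt_eqF //.
    rewrite normrM normfV (gtr0_norm q0) ler_pdivrMr //.
    rewrite -(@ler_pXn2r _ 2) ?nnegrE ?normr_ge0 //; last by rewrite mulr_ge0 ?(ltW q0) //; lra.
    rewrite exprMn q2 real_normK ?num_real //.
    have eI : complex.Im b ^+ 2 = B ^+ 2 - complex.Re b ^+ 2 by rewrite /B sqr_normcE; ring.
    have r2 : complex.Re b ^+ 2 <= B ^+ 2 by rewrite -subr_ge0 -eI sqr_ge0.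
    have h := sqr_ge0 ((1 - c) * complex.Re b + B ^+ 2).
    have h7 : 1 <= (8 / 7 * (1 - c)) ^+ 2 by nra.
    set r := complex.Re b in h r2 eI *.
    have : (B ^+ 2 - r ^+ 2) * ((8 / 7 * (1 - c)) ^+ 2 - 1) >= 0.
      by apply: mulr_ge0; lra.
    rewrite eI; nra.
  - have B64 : 0 <= B ^+ 2 * (64^-1 - B ^+ 2) by apply: mulr_ge0; [exact: sqr_ge0 | nra].
    nra.
(* Divided by [H], the curve point of [E = H K] is [K + g conj K^k] for this [g]; it has to be
   real. *)
have [|K [K1 K0 Kim]] := @unit_real_value (conj b * conj H ^+ k.+1) k.
  by rewrite normcM normcX !normc_conj H1 expr1n mulr1 -/B; lra.
set g := conj b * _ in Kim.
have g1 : normc g = B by rewrite normcM normcX !normc_conj H1 expr1n mulr1.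
have gK : normc (g * conj K ^+ k) = B.
  by rewrite normcM normcX normc_conj K1 expr1n g1 mulr1.
have KI : `|complex.Im K| <= B.
  have /eqP : complex.Im K + complex.Im (g * conj K ^+ k) = 0 by rewrite -Kim raddfD.
  rewrite addr_eq0 => /eqP ->; rewrite normrN -gK.
  rewrite -(@ler_pXn2r _ 2) ?nnegrE ?normc_ge0 //.
  by rewrite real_normK ?num_real // [leRHS]sqr_normcE lerDr sqr_ge0.
have dK : normc (1 - K) <= 251 / 250 * B.
  apply: (@unit_chord_le _ K B) => //; try lra.
  have B64 : 0 <= B ^+ 2 * (64^-1 - B ^+ 2) by apply: mulr_ge0; [exact: sqr_ge0 | nra].
  nra.
pose E := H * K; pose rho := complex.Re (K + g * conj K ^+ k).
have E1 : normc E = 1 by rewrite normcM H1 K1 mulr1.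
have HH : conj H * H = 1 by rewrite conjc_mul_norm H1 expr1n.
have XE : E + conj b * conj E ^+ k = H * rho%:C.
  have -> : rho%:C = K + g * conj K ^+ k.
    by rewrite [RHS]complexE Kim mulr0 addr0.
  rewrite mulrDr -/E conjcM exprMn /g exprSr; congr (_ + _).
  by rewrite -[in LHS](mulr1 (conj b)) -HH; ring.
have dE : normc (1 - E) <= 13 / 6 * B.
  have -> : 1 - E = (1 - H) + H * (1 - K) by rewrite /E; ring.
  by rewrite (le_trans (le_normcD _ _)) // normcM H1 mul1r; lra.
have rho2 : rho ^+ 2 = 1 + B ^+ 2 + 2 * complex.Re (b * E ^+ k.+1).
  have -> : rho ^+ 2 = normc (E + conj b * conj E ^+ k) ^+ 2.
    by rewrite XE normcM H1 mul1r normc_real real_normK ?num_real.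
  rewrite sqr_normcD E1 normcM normcX !normc_conj E1 !expr1n mulr1 -/B.
  congr (_ + 2 * _); rewrite -conjcX exprS.
  have -> : conj E * (conj b * conj (E ^+ k)) = conj (b * (E * E ^+ k)).
    by rewrite !conjcM; ring.
  by case: (b * _).
have rho0 : 0 < rho.
  have Kr : 1 - B ^+ 2 <= complex.Re K.
    have : B ^+ 2 >= complex.Im K ^+ 2.
      by rewrite -(real_normK (num_real (complex.Im K))) ler_pXn2r ?nnegrE.
    have := sqr_normcE K; rewrite K1 expr1n; nra.
  have : - complex.Re (g * conj K ^+ k) <= B.
    rewrite -gK -[leRHS]normcN (le_trans _ (Re_le_normc _)) //.
    by case: (g * _).
  rewrite /rho raddfD /=; nra.
have qrho : q <= rho.
  rewrite -(@ler_pXn2r _ 2) ?nnegrE ?(ltW q0) ?(ltW rho0) // rho2 q2 -subr_ge0.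
  have h : complex.Re (b * (1 - E ^+ k.+1)) <= B * (k.+1%:R * (13 / 6 * B)).
    rewrite (le_trans (Re_le_normc _)) // normcM ler_wpM2l //.
    by rewrite (le_trans (normc_sub1X_le _ _ E1)) // ler_wpM2l.
  have e : complex.Re (b * (1 - E ^+ k.+1)) =
      complex.Re b - complex.Re (b * E ^+ k.+1).
    by rewrite mulrBr mulr1 raddfB.
  rewrite e -natr1 in h.
  move: ReB; rewrite ler_norml => /andP[h1 h2].
  have cE : c = 4 * k%:R * B * B by rewrite /c; ring.
  have c3 : - (c * complex.Re b) <= c * B by rewrite -mulrN ler_wpM2l //; lra.
  have kc2 : c * c <= B * B by apply: ler_pM.
  have kc3 : c * B <= B * B by rewrite ler_wpM2r.
  (* In units of [B^2]: [8k] from [2c], less 3 from [c^2] and [2 c |Re b|], less [13/3 (k + 1)] from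
     the chord, leaves [11/3 (k - 2)]. *)
  have kB2 : 0 <= (k%:R - 2) * (B * B) by rewrite mulr_ge0 ?mulr_ge0 //; lra.
  nra.
exists E, (q / rho); split=> //.
  rewrite divr_ge0 ?(ltW q0) ?(ltW rho0) //=.
  by rewrite ler_pdivrMr // mul1r.
rewrite XE mulrCA -rmorphM /= divfK ?gt_eqF // mulrC -QH.
by [].
Qed.

End BoundaryCurve.

(** * Squared Euclidean norm *)

Section SquaredNorm.
Context {R : realType}.
Local Notation C := R[i].
Local Open Scope sesquilinear_scope.

(** The square of [norm2]: it avoids roots and splits over coordinates and orbits. *)
Definition sqn n (x : 'cV[C]_n) : R := \sum_i normc (x i 0) ^+ 2.

Lemma sqn_ge0 n (x : 'cV[C]_n) : 0 <= sqn n x.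
Proof. by apply: sumr_ge0 => i _; apply: sqr_ge0. Qed.

Lemma sqnE n (x : 'cV[C]_n) : (x ^t* *m x) 0 0 = (sqn n x)%:C.
Proof.
rewrite mxE rmorph_sum; apply: eq_bigr => i _.
by rewrite !mxE conjc_mul_norm.
Qed.

Lemma sqnZ n (a : C) (x : 'cV[C]_n) : sqn n (a *: x) = normc a ^+ 2 * sqn n x.
Proof.
rewrite /sqn mulr_sumr; apply: eq_bigr => i _.
by rewrite mxE normcM exprMn.
Qed.

Lemma sqn_eq0 n (x : 'cV[C]_n) : sqn n x = 0 -> x = 0.
Proof.
move=> /eqP; rewrite psumr_eq0 => [/allP h|i _]; last exact: sqr_ge0.
apply/colP => i; have := h i (mem_index_enum i).
by rewrite /= expf_eq0 /= mxE => /eqP /eq0_normc.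
Qed.

Lemma sqn_isometry m n (P : 'M[C]_(m, n)) (x : 'cV[C]_n) :
  P ^t* *m P = 1%:M -> sqn m (P *m x) = sqn n x.
Proof.
move=> PP; apply: complexI; rewrite -!sqnE trmx_mul map_mxM.
by rewrite mulmxA -(mulmxA _ _ P) PP mulmx1.
Qed.

Lemma numrangeE n (M : 'M[C]_n) (x : 'cV[C]_n) : sqn n x = 1 ->
  numrange M ((x ^t* *m M *m x) 0 0).
Proof.
by move=> x1; exists x => //=; apply/matrixP => i j; rewrite !ord1 sqnE x1 mxE.
Qed.

End SquaredNorm.

(** * Polynomials in intertwined matrices *)

Section PolynomialCalculus.

(** Serves for diagonal similarities, unitary diagonalisation, commuting powers and, with [S]
    rectangular, restriction to a cycle. *)
Lemma horner_mx_intertwine (K : comNzRingType) m n (A : 'M[K]_m.+1)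
    (B : 'M[K]_n.+1) (S : 'M[K]_(m.+1, n.+1)) (p : {poly K}) :
  A *m S = S *m B -> horner_mx A p *m S = S *m horner_mx B p.
Proof.
move=> AS; elim/poly_ind: p => [|p c IH].
  by rewrite !rmorph0 mul0mx mulmx0.
rewrite !rmorphD !rmorphM /= !horner_mx_X !horner_mx_C mulmxDl mulmxDr.
congr (_ + _); last by rewrite mul_scalar_mx mul_mx_scalar.
by rewrite -!mulmxE -mulmxA AS mulmxA IH mulmxA.
Qed.

Lemma horner_mx_comp (K : comNzRingType) n (A : 'M[K]_n.+1) (p g : {poly K}) :
  horner_mx A (p \Po g) = horner_mx (horner_mx A g) p.
Proof.
elim/poly_ind: p => [|p c IH]; first by rewrite comp_poly0 !rmorph0.
by rewrite comp_polyD comp_polyM comp_polyX comp_polyC !rmorphD !rmorphM /=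
  !horner_mx_X !horner_mx_C IH.
Qed.

End PolynomialCalculus.

(** * Unitary matrices of finite order *)

Section UnitaryCalculus.
Context {R : realType}.
Local Notation C := R[i].
Local Open Scope sesquilinear_scope.

(** By the spectral theorem [U] is unitarily diagonalisable, and [U ^+ N = 1] makes its eigenvalues
    [N]-th roots of unity. *)
Lemma unitary_horner_le n (U : 'M[C]_n.+1) (q : {poly C}) (N : nat) (K : R) x :
  U \is unitarymx -> U ^+ N = 1 -> 0 <= K ->
  (forall z, z ^+ N = 1 -> normc q.[z] <= K) ->
  sqn _ (horner_mx U q *m x) <= K ^+ 2 * sqn _ x.
Proof.
move=> Uu UN K0 hq.
have Un : U \is normalmx.
  apply/normalmxP; rewrite (unitarymxP Uu).
  by move: Uu; rewrite -trmxC_unitary => /unitarymxP; rewrite trmxCK.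
set P := spectralmx U; set d := spectral_diag U.
have Pu : P \is unitarymx by exact: spectral_unitarymx.
have PU : diag_mx d *m P = P *m U.
  have /orthomx_spectralP UE := Un; rewrite [in RHS]UE -/P -/d !mulmxA mulmxV ?mul1mx //.
  exact: unitarymx_unit.
have PP : P ^t* *m P = 1%:M.
  by move: Pu; rewrite -trmxC_unitary => /unitarymxP; rewrite trmxCK.
have PPt : P *m P ^t* = 1%:M by apply/unitarymxP.
have dN i : d 0 i ^+ N = 1.
  have e : diag_mx d ^+ N = 1.
    have h : horner_mx (diag_mx d) 'X^N *m P = P *m horner_mx U 'X^N.
      exact: horner_mx_intertwine.
    move: h; rewrite !rmorphXn /= !horner_mx_X UN mulmx1 => h.
    by rewrite -[LHS]mulmx1 -PPt mulmxA h.
  have : horner_mx (diag_mx d) 'X^N = 1 by rewrite rmorphXn /= horner_mx_X.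
  rewrite horner_mx_diag => /matrixP /(_ i i).
  by rewrite !mxE !eqxx /= !mulr1n hornerXn.
rewrite -(sqn_isometry _ _ P _ PP) mulmxA -(horner_mx_intertwine _ _ _ _ _ _ q PU).
rewrite -mulmxA -(sqn_isometry _ _ P x PP); set y := P *m x.
rewrite horner_mx_diag /sqn mulr_sumr ler_sum // => i _.
rewrite mul_diag_mx !mxE normcM exprMn ler_wpM2r ?sqr_ge0 //.
by rewrite ler_pXn2r ?nnegrE ?normc_ge0 // hq.
Qed.
End UnitaryCalculus.

(** * AM-GM vectors on a path *)

Section BalancedChain.
Context {R : realType}.

(* The vector (1/sqrt 2, 1, ..., 1, 1/sqrt 2) / sqrt j, whose interior entries
   are then shrunk by a common factor g to turn the AM-GM inequality into an
   equality. *)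
Lemma balanced_chain j (a : nat -> R) (N : R) : (0 < j)%N -> 0 <= N ->
  (forall l, (l < j)%N -> 0 <= a l) -> \prod_(l < j) a l = 2 * N ^+ j ->
  exists y : nat -> R, [/\ y 0 * y j = (2 * j%:R)^-1,
    \sum_(l < j.+1) y l ^+ 2 <= 1 &
    \sum_(l < j) a l * (y l * y l.+1) = N].
Proof.
move=> j0 N0 a0 aN.
have jR : 0 < j%:R :> R by rewrite ltr0n.
pose h : R := Num.sqrt 2^-1.
have hh : h * h = 2^-1 by rewrite -expr2 sqr_sqrtr // invr_ge0.
have h0 : 0 <= h by apply: sqrtr_ge0.
pose t (g : R) l := if (l == 0) || (l == j) then h else g.
have tE g l : (0 < l < j)%N -> t g l = g.
  by case/andP=> l0 lj; rewrite /t (gtn_eqF l0) (ltn_eqF lj).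
have t0 g : t g 0%N = h by [].
have tj g : t g j = h by rewrite /t eqxx orbT.
pose F g := \sum_(l < j) a l * (t g l * t g l.+1).
suff [g [g0 g1 Fg]] : exists g, [/\ 0 <= g, g <= 1 & F g = j%:R * N].
  pose s : R := Num.sqrt j%:R^-1.
  have ss : s * s = j%:R^-1 by rewrite -expr2 sqr_sqrtr // invr_ge0 ltW.
  exists (fun l => s * t g l); split.
  - by rewrite t0 tj mulrACA ss hh -invfM mulrC.
  - rewrite (eq_bigr (fun l : 'I__ => j%:R^-1 * t g l ^+ 2)); last first.
      by move=> l _; rewrite exprMn [s ^+ 2]expr2 ss.
    rewrite -mulr_sumr mulrC ler_pdivrMr // mul1r.
    rewrite big_ord_recr -(prednK j0) big_ord_recl /= (prednK j0) t0 tj.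
    rewrite addrAC -expr2 in hh *; rewrite hh.
    have -> : 2^-1 + 2^-1 = 1 :> R by field.
    rewrite -[leRHS](@subrK _ 1) addrC lerD2r.
    rewrite -[leRHS](_ : \sum_(i < j.-1) 1 = _); last first.
      by rewrite sumr_const card_ord -(natrB _ j0) subn1.
    rewrite ler_sum // => l _; rewrite tE ?expr_le1 //.
    by rewrite /bump /= add1n -[X in (_ < X)%N](prednK j0) ltnS ltn_ord.
  - rewrite (eq_bigr (fun l : 'I__ => j%:R^-1 * (a l * (t g l * t g l.+1)))).
      by rewrite -mulr_sumr -/(F g) Fg mulKf // gt_eqF.
    by move=> l _; rewrite -ss; ring.
(* A single edge joins the two end entries: nothing has to be shrunk. *)
have [j1|j1] := eqVneq j 1%N.
  subst j; exists 1; split=> //; rewrite /F big_ord1 t0 tj hh.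
  by move: aN; rewrite big_ord1 => ->; field.
have [k jk] : exists k, j = k.+2 by exists j.-2; lia.
subst j; rename k into j.
have t1 g : t g 1%N = g by apply: tE.
have tj1 g : t g j.+1 = g by apply: tE; rewrite /= ltnS leqnn.
have tm g (l : 'I_j) : t g (bump 0 l) = g /\ t g (bump 0 l).+1 = g.
  by have lj := ltn_ord l; rewrite /bump /= add1n; split; apply: tE; lia.
pose P := (a 0 + a j.+1) * h; pose S := \sum_(l < j) a (bump 0 l).
have FE g : F g = P * g + S * g ^+ 2.
  rewrite /F big_ord_recr big_ord_recl /= t0 t1 tj1 tj /P /S mulr_suml.
  rewrite (eq_bigr (fun l : 'I_j => a (bump 0 l) * g ^+ 2)); last first.
    by move=> l _; have [-> ->] := tm g l; rewrite expr2.
  by ring.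
(* The end entries contribute [h * h = 1/2], cancelling the factor 2 in the product, so the terms of
   [F 1] have geometric mean [N]. As [F 0 = 0], an intermediate [g] then attains equality. *)
have FN : j.+2%:R * N <= F 1.
  have e0 l : (l < j.+2)%N -> 0 <= a l * (t 1 l * t 1 l.+1).
    move=> lj; rewrite mulr_ge0 ?a0 // mulr_ge0 // /t; case: ifP => //.
  have := @leif_AGM R 'I_j.+2 predT (fun l => a l * (t 1 l * t 1 l.+1)) _.
  rewrite cardT size_enum_ord => /(_ (fun l _ => e0 l (ltn_ord l))) [+ _].
  rewrite -/(F 1) big_split /= aN big_ord_recr big_ord_recl /= t0 t1 tj1 tj big1; last first.
    by move=> l _; have [-> ->] := tm 1 l; rewrite mulr1.
  have -> : 2 * N ^+ j.+2 * (h * 1 * 1 * (1 * h)) = N ^+ j.+2 * (2 * (h * h)) by ring.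
  have e2 : 2 * 2^-1 = 1 :> R by field.
  rewrite hh e2 mulr1 ler_pXn2r ?nnegrE //.
    by rewrite ler_pdivlMr // mulrC.
  by rewrite divr_ge0 // sumr_ge0 // => l _; apply: e0.
pose p : {poly R} := S *: 'X^2 + P *: 'X - (j.+2%:R * N)%:P.
have pE x : p.[x] = F x - j.+2%:R * N.
  by rewrite /p !hornerD hornerN !hornerZ hornerXn hornerX hornerC FE [S * _ + _]addrC.
have [||g /andP[g0 g1] /rootP] := @poly_ivt R p 0 1.
- by [].
- rewrite !pE subr_ge0 FN andbT FE mulr0 expr2 !mulr0 add0r sub0r oppr_le0.
  by rewrite mulr_ge0.
by rewrite pE => /subr0_eq e; exists g.
Qed.
End BalancedChain.

(** * Cyclic weighted shifts *)

Section CyclicShift.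
Context {R : realType}.
Local Notation C := R[i].
Local Open Scope sesquilinear_scope.

(** Weights are indexed by all naturals, and later assumed periodic, so that a run of consecutive
    weights can wrap around without explicit reduction of indices. *)
Definition cshift n (w : nat -> C) : 'M[C]_n.+1 :=
  \matrix_(i, j) (w i *+ (j == inZp i.+1)).

Lemma inZpD n a b : inZp ((inZp a : 'I_n.+1) + b) = inZp (a + b) :> 'I_n.+1.
Proof. by apply: val_inj; rewrite /= modnDml. Qed.

Lemma periodic_modn (T : Type) n (w : nat -> T) k :
  (forall k, w (k + n)%N = w k) -> w (k %% n)%N = w k.
Proof.
move=> wn; rewrite [in RHS](divn_eq k n) addnC.
by elim: (k %/ n)%N => [|q IH]; rewrite ?mul0n ?addn0 // mulSnr addnA wn.
Qed.

Lemma cshiftE n w (x : 'cV[C]_n.+1) (i : 'I_n.+1) :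
  (cshift n w *m x) i 0 = w i * x (inZp i.+1) 0.
Proof.
rewrite mxE (bigD1 (inZp i.+1)) //= mxE eqxx mulr1n big1 ?addr0 // => j jn.
by rewrite mxE (negPf jn) mulr0n mul0r.
Qed.

Lemma cshift_powE n w (x : 'cV[C]_n.+1) j k :
  (forall k, w (k + n.+1)%N = w k) ->
  (cshift n w ^+ j *m x) (inZp k) 0 =
  (\prod_(l < j) w (k + l)%N) * x (inZp (k + j)) 0.
Proof.
move=> wn; elim: j k => [|j IH] k.
  by rewrite expr0 mul1mx big_ord0 mul1r addn0.
rewrite exprS -mulmxE -mulmxA cshiftE -[(inZp k).+1]addn1 inZpD IH.
rewrite /= periodic_modn // big_ord_recl addn0 -!mulrA addn1 addSnnS.
by congr (_ * (_ * _)); apply: eq_bigr => l _; rewrite /bump /= addnA addn1.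
Qed.

Lemma cshift1_unitary n : cshift n (fun=> 1) \is unitarymx.
Proof.
apply/unitarymxP/matrixP => i j; rewrite !mxE.
rewrite (bigD1 (inZp i.+1)) //= big1 ?addr0 => [|k kn]; last first.
  by rewrite !mxE (negPf kn) mul0r.
rewrite !mxE eqxx mul1r /=.
have -> : (inZp i.+1 == inZp j.+1 :> 'I_n.+1) = (i == j).
  apply/eqP/eqP => [/(congr1 val) /= /eqP|->//].
  rewrite -(addn1 i) -(addn1 j) eqn_modDr !modn_small // => /eqP ij; exact: val_inj.
by case: eqP => _; rewrite ?rmorph1 ?rmorph0.
Qed.

Lemma cshift1_expn n : cshift n (fun=> 1) ^+ n.+1 = 1.
Proof.
apply/matrixP => i j.
have := cshift_powE n (fun=> 1) (delta_mx j 0) n.+1 i (fun=> erefl).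
rewrite -colE !mxE valZpK big1 ?mul1r // => ->.
suff -> : inZp (i + n.+1) = i by rewrite eqxx andbT.
by apply: val_inj; rewrite /= modnDr modn_small.
Qed.

Lemma horner_mxE n (A : 'M[C]_n.+1) (q : {poly C}) (x : 'cV[C]_n.+1) :
  horner_mx A q *m x = \sum_(j < size q) q`_j *: (A ^+ j *m x).
Proof.
rewrite -{1}[q]coefK poly_def rmorph_sum mulmx_suml; apply: eq_bigr => j _.
by rewrite /= horner_mxZ rmorphXn /= horner_mx_X scalemxAl.
Qed.

(** A finite Parseval bound. The inner sum is entry [k] of [q(V)] applied to [xi], where [V] is a
    cyclic permutation matrix large enough that no [k + j] wraps around; [V] is unitary of finite
    order. *)
Lemma correlation_le (N : nat) (q : {poly C}) (xi : nat -> C) (K : R) :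
  0 <= K -> (forall z, normc z = 1 -> normc q.[z] <= K) ->
  \sum_(k < N) normc (\sum_(j < size q) q`_j * xi (k + j)%N) ^+ 2 <=
  K ^+ 2 * \sum_(k < (N + size q).+1) normc (xi k) ^+ 2.
Proof.
move=> K0 hq; set L := (N + size q)%N.
pose x : 'cV[C]_L.+1 := \col_i xi i.
have hq' z : z ^+ L.+1 = 1 -> normc q.[z] <= K.
  move=> zL; apply: hq; apply/eqP; rewrite -(@pexpr_eq1 _ _ L.+1) ?normc_ge0 //.
  by rewrite -normcX zL normc1.
have -> : \sum_(k < L.+1) normc (xi k) ^+ 2 = sqn L.+1 x.
  by apply: eq_bigr => i _; rewrite mxE.
apply: le_trans (unitary_horner_le _ (cshift L (fun=> 1)) q L.+1 K x
  (cshift1_unitary L) (cshift1_expn L) K0 hq').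
rewrite /sqn; have NL : (N <= L.+1)%N by rewrite /L; lia.
rewrite (big_ord_widen_cond _ xpredT
  (fun k => normc (\sum_(j < size q) q`_j * xi (k + j)%N) ^+ 2) NL).
rewrite [leLHS]big_mkcond /=; apply: ler_sum => k _; case: ifP => [kN|_]; last exact: sqr_ge0.
rewrite horner_mxE summxE le_eqVlt; apply/orP; left; apply/eqP; congr (normc _ ^+ 2).
apply: eq_bigr => j _; rewrite mxE -[k in RHS]valZpK cshift_powE // big1 // mul1r mxE.
by rewrite /= modn_small // ltnS leq_add ?(ltnW kN) ?(ltnW (ltn_ord j)).
Qed.

Lemma normc_bound_ge0 (q : {poly C}) (K : R) :
  (forall z, normc z = 1 -> normc q.[z] <= K) -> 0 <= K.
Proof. by move=> /(_ 1 (normc1 _)); apply: le_trans (normc_ge0 _). Qed.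

End CyclicShift.

(** * Von Neumann's inequality in a weighted norm *)

Section Contraction.
Context {R : realType}.
Local Notation C := R[i].

Definition wsqn n (s : 'I_n -> R) (x : 'cV[C]_n) : R :=
  \sum_i s i * normc (x i 0) ^+ 2.

(** Let [t] tend to infinity; this disposes of the tail in the telescoped sum below. *)
Lemma geometric_absorb (a Y B : R) : 0 <= a < 1 ->
  (forall t, (1 - a ^+ t) * Y <= B) -> Y <= B.
Proof.
move=> /andP[a0 a1] h.
have cv : ((1 - a ^+ t) * Y @[t --> \oo] --> (1 - 0) * Y)%classic.
  apply: cvgM; last exact: cvg_cst.
  apply: cvgB; first exact: cvg_cst.
  by apply: sequences.cvg_expr; rewrite ger0_norm.
have e : lim ((1 - a ^+ t) * Y @[t --> \oo])%classic = Y.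
  by rewrite (cvg_lim _ cv) ?subr0 ?mul1r.
rewrite -e; apply: limr_le; first by apply: cvgP cv.
by apply: nearW => t; apply: h.
Qed.

(* The deficiency form sum_i e_i |x_i|^2 of the contraction T plays the role of
   |D_T x|^2 in the functional model: x |-> (D_T T^k x)_k turns T into a
   backward shift, where q(T) is dominated by sup |q| by Parseval. *)
Lemma contraction_horner_le n (T : 'M[C]_n.+1) (s e : 'I_n.+1 -> R) (m : nat)
    (kappa : C) (q : {poly C}) (K : R) (x : 'cV[C]_n.+1) :
  (forall i, 0 <= s i) -> (forall i, 0 <= e i) ->
  (forall y, wsqn _ s y - wsqn _ s (T *m y) = \sum_i e i * normc (y i 0) ^+ 2) ->
  T ^+ m = kappa%:M -> normc kappa < 1 ->
  (forall z, normc z = 1 -> normc q.[z] <= K) ->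
  wsqn _ s (horner_mx T q *m x) <= K ^+ 2 * wsqn _ s x.
Proof.
move=> s0 e0 hT Tm k1 hq.
have K0 := normc_bound_ge0 _ _ hq.
have w0 y : 0 <= wsqn _ s y.
  by apply: sumr_ge0 => i _; rewrite mulr_ge0 ?sqr_ge0.
have tel N y : wsqn _ s y - wsqn _ s (T ^+ N *m y) =
    \sum_i e i * \sum_(k < N) normc ((T ^+ k *m y) i 0) ^+ 2.
  elim: N => [|N IH].
    by rewrite expr0 mul1mx subrr big1 // => i _; rewrite big_ord0 mulr0.
  rewrite exprS -mulmxE -mulmxA -[LHS](subrKA (wsqn _ s (T ^+ N *m y))) IH hT.
  rewrite -big_split; apply: eq_bigr => i _ /=.
  by rewrite big_ord_recr /= mulrDr.
set y := horner_mx T q *m x.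
(* In each coordinate [i], the entries of [T^k y] are correlations of [xi k = (T^k x)_i] with the
   coefficients of [q]. *)
have main N : wsqn _ s y - wsqn _ s (T ^+ N *m y) <= K ^+ 2 * wsqn _ s x.
  apply: (@le_trans _ _ (K ^+ 2 * (wsqn _ s x - wsqn _ s (T ^+ (N + size q).+1 *m x)))).
    rewrite !tel mulr_sumr; apply: ler_sum => i _.
    rewrite mulrCA ler_wpM2l //.
    pose xi k := (T ^+ k *m x) i 0.
    apply: le_trans (correlation_le N q xi K K0 hq).
    rewrite le_eqVlt; apply/orP; left; apply/eqP; apply: eq_bigr => k _.
    congr (normc _ ^+ 2); rewrite /y mulmxA.
    have -> : T ^+ k *m horner_mx T q = horner_mx T q *m T ^+ k.
      by rewrite (horner_mx_intertwine _ _ _ _ T (T ^+ k)) // mulmxE -exprSr -exprS.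
    rewrite -mulmxA horner_mxE summxE; apply: eq_bigr => j _.
    by rewrite mxE mulmxA mulmxE -exprD addnC.
  by rewrite ler_wpM2l ?sqr_ge0 // gerBl.
apply: (@geometric_absorb (normc kappa ^+ 2)).
  by rewrite sqr_ge0 /= expr_lt1 ?normc_ge0.
(* Along exponents [m t] the power of [T] is the scalar [kappa^t], so the tail is a geometric
   multiple of the norm of [y]. *)
move=> t; apply: le_trans (main (m * t)%N).
have -> : wsqn _ s (T ^+ (m * t) *m y) = (normc kappa ^+ 2) ^+ t * wsqn _ s y.
  rewrite exprM Tm.
  have -> : (kappa%:M : 'M[C]_n.+1) ^+ t = (kappa ^+ t)%:M.
    by elim: t => [|t IH]; rewrite ?expr0 // !exprS IH -mulmxE -scalar_mxM.
  rewrite mul_scalar_mx /wsqn mulr_sumr; apply: eq_bigr => i _.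
  by rewrite mxE normcM exprMn normcX -exprM mulnC exprM mulrCA.
by rewrite mulrBl mul1r.
Qed.

End Contraction.

(** * Numerical range and star-shapedness about 0 *)

Section NumericalRange.
Context {R : realType}.
Local Notation C := R[i].
Local Notation conj := (@conjc R).
Local Open Scope sesquilinear_scope.

Definition qform n (M : 'M[C]_n) (x y : 'cV[C]_n) : C := (x ^t* *m M *m y) 0 0.

Lemma qformE n (M : 'M[C]_n) x y : qform n M x y = \sum_i conj (x i 0) * (M *m y) i 0.
Proof. by rewrite /qform -mulmxA mxE; apply: eq_bigr => i _; rewrite !mxE. Qed.

Lemma qform1 n (x : 'cV[C]_n) : qform n 1%:M x x = (sqn n x)%:C.
Proof. by rewrite /qform mulmx1 sqnE. Qed.

Lemma qformZ n (M : 'M[C]_n) (a : C) x :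
  qform n M (a *: x) (a *: x) = (normc a ^+ 2)%:C * qform n M x x.
Proof.
rewrite !qformE mulr_sumr; apply: eq_bigr => i _.
by rewrite -scalemxAr !mxE conjcM -conjc_mul_norm; ring.
Qed.

Lemma qformZD n (M : 'M[C]_n) (a : C) x y :
  qform n M (a *: x + y) (a *: x + y) = (normc a ^+ 2)%:C * qform n M x x +
   (conj a * qform n M x y + a * qform n M y x) + qform n M y y.
Proof.
rewrite !qformE !mulr_sumr -!big_split; apply: eq_bigr => i _ /=.
by rewrite mulmxDr -scalemxAr !mxE conjcD conjcM -conjc_mul_norm; ring.
Qed.

Lemma numrange_scale n (M : 'M[C]_n) (x : 'cV[C]_n) (z : C) : 0 < sqn n x ->
  qform n M x x = (sqn n x)%:C * z -> numrange M z.
Proof.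
move=> x0 xz; pose s := (Num.sqrt (sqn n x))^-1.
have s2 : s ^+ 2 * sqn n x = 1.
  by rewrite exprVn sqr_sqrtr ?ltW // mulVf // gt_eqF.
have n2 : normc s%:C ^+ 2 = s ^+ 2 by rewrite normc_real real_normK ?num_real.
have -> : z = qform n M (s%:C *: x) (s%:C *: x).
  by rewrite qformZ xz n2 mulrA -rmorphM s2 mul1r.
by apply: numrangeE; rewrite sqnZ n2.
Qed.

(* For unit vectors x, e with e^*Me = 0, the phase of a is chosen so that the
   cross terms of (a x + e)^* M (a x + e) lie on the line through z; the
   modulus of a then solves a real quadratic equation. *)
Lemma numrange_star n (M : 'M[C]_n) (z : C) (s : R) :
  numrange M 0 -> numrange M z -> 0 <= s <= 1 -> numrange M (s%:C * z).
Proof.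
move=> M0 Mz /andP[s0]; rewrite le_eqVlt => /orP[/eqP ->|s1].
  by rewrite mul1r.
have [->|z0] := eqVneq z 0; first by rewrite mulr0.
case: M0 => e /= e1 ez; case: Mz => x /= x1 xz.
change (qform n M e e = 0) in ez; change (qform n M x x = z) in xz.
have {}e1 : sqn n e = 1.
  by apply: complexI; rewrite -sqnE e1 mxE.
have {}x1 : sqn n x = 1.
  by apply: complexI; rewrite -sqnE x1 mxE.
(* [conj u X + u Y] has the imaginary part of [u (Y - conj X)]; the phase [u] makes this product
   real. *)
pose u0 := qform n M e x / z - conj (qform n M x e / z).
pose u := if u0 == 0 then 1 else conj u0 / (normc u0)%:C.
have u1 : normc u = 1.
  rewrite /u; case: eqP => [_|/eqP h]; first exact: normc1.
  have hp := normc_gt0 _ h.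
  by rewrite normcM normcV normc_conj normc_real gtr0_norm // mulfV ?gt_eqF.
have uu0 : complex.Im (u * u0) = 0.
  rewrite /u; case: eqP => [->|_]; first by rewrite mulr0.
  by rewrite mulrAC conjc_mul_norm -fmorphV -rmorphM.
pose c := complex.Re (conj u * (qform n M x e / z) + u * (qform n M e x / z)).
have cE : conj u * qform n M x e + u * qform n M e x = c%:C * z.
  have -> : c%:C = conj u * (qform n M x e / z) + u * (qform n M e x / z).
    rewrite [RHS]complexE -/c; set i := complex.Im _.
    suff -> : i = 0 by rewrite mulr0 addr0.
    rewrite -uu0 /i /u0.
    by case: (u) (_ / z) (_ / z) => a b [a1 b1] [a2 b2] /=; ring.
  by rewrite mulrDl -!mulrA !mulVf // !mulr1.
pose d := complex.Re (conj u * qform n 1%:M x e + u * qform n 1%:M e x).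
have q1 : qform n 1%:M x e = conj (qform n 1%:M e x).
  rewrite !qformE !mul1mx (rmorph_sum (@conjc R)); apply: eq_bigr => i _ /=.
  by rewrite conjcM conjcK mulrC.
have dE : conj u * qform n 1%:M x e + u * qform n 1%:M e x = d%:C.
  rewrite [LHS]complexE -/d; set i := complex.Im _.
  suff -> : i = 0 by rewrite mulr0 addr0.
  by rewrite /i q1; case: (u) (qform _ _ _ _) => a b [a1 b1] /=; ring.
(* The form at [v = a u x + e] is [(a^2 + a c) z], and [|v|^2 = a^2 + a d + 1]. Asking for ratio
   [s z] gives [(1 - s) a^2 + B a - s = 0], with discriminant [D]. *)
pose B := c - s * d; pose D := B ^+ 2 + 4 * (1 - s) * s.
have D0 : 0 <= D.
  by rewrite addr_ge0 ?sqr_ge0 // !mulr_ge0 //; lra.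
have [a aE] : exists a : R, (1 - s) * a ^+ 2 + B * a - s = 0.
  exists ((Num.sqrt D - B) / (2 * (1 - s))).
  have := sqr_sqrtr D0; rewrite /D; set r := Num.sqrt _ => rE.
  have -> : (1 - s) * ((r - B) / (2 * (1 - s))) ^+ 2 + B * ((r - B) / (2 * (1 - s))) - s
     = (r ^+ 2 - (B ^+ 2 + 4 * (1 - s) * s)) / (4 * (1 - s)).
    by field; rewrite gt_eqF //; lra.
  by rewrite rE subrr mul0r.
pose v := (a%:C * u) *: x + e.
have au : normc (a%:C * u) ^+ 2 = a ^+ 2.
  by rewrite normcM u1 mulr1 normc_real real_normK ?num_real.
have cau : conj (a%:C * u) = a%:C * conj u by rewrite conjcM conjc_real.
have vN : sqn n v = a ^+ 2 + a * d + 1.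
  apply: complexI; rewrite -qform1 qformZD !qform1 x1 e1 au cau.
  rewrite -!mulrA -mulrDr dE !rmorphD !rmorphM rmorph1 /=; ring.
have vM : qform n M v v = (a ^+ 2 + a * c)%:C * z.
  rewrite qformZD xz ez addr0 au cau.
  rewrite -!mulrA -mulrDr cE !rmorphD !rmorphM /=; ring.
have sv : a ^+ 2 + a * c = sqn n v * s by rewrite vN; move: aE; rewrite /B; lra.
apply: (numrange_scale n M v); last by rewrite vM sv rmorphM /= mulrA.
(* If [v = 0] then [e = - a u x], so [0 = e^* M e = a^2 z] forces [a = 0] and [e = 0]. *)
rewrite lt_neqAle sqn_ge0 andbT eq_sym; apply/eqP => v0.
have := sqn_eq0 _ _ v0; rewrite /v => /eqP; rewrite addrC addr_eq0 => /eqP ev.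
have := ez.
rewrite ev -scaleNr qformZ normcN au xz => /eqP.
rewrite mulf_eq0 (negPf z0) orbF => /eqP /complexI /eqP.
rewrite expf_eq0 /= => /eqP a0.
move: e1; rewrite ev a0 mul0r scale0r oppr0 /sqn big1 => [/eqP|i _].
  by rewrite eq_sym oner_eq0.
by rewrite mxE normc0 expr0n.
Qed.

(** Normalising [x] divides the form by [|x|^2 <= 1]; star-shapedness restores this factor together
    with [s]. *)
Lemma numrange_ball n (M : 'M[C]_n) (x : 'cV[C]_n) (s : R) :
  numrange M 0 -> sqn n x <= 1 -> 0 <= s <= 1 -> numrange M (s%:C * qform n M x x).
Proof.
move=> M0 x1 /andP[s0 s1].
have [x0|xN0] := eqVneq (sqn n x) 0.
  by rewrite (sqn_eq0 _ _ x0) /qform mulmx0 mxE mulr0.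
have xp : 0 < sqn n x by rewrite lt_neqAle sqn_ge0 eq_sym xN0.
have xC : (sqn n x)%:C != 0 :> C by rewrite fmorph_eq0.
have -> : s%:C * qform n M x x = (s * sqn n x)%:C * (qform n M x x / (sqn n x)%:C).
  by rewrite rmorphM /=; field.
apply: numrange_star => //; last by rewrite mulr_ge0 ?mulr_ile1 ?(ltW xp).
by apply: (numrange_scale n M x) => //; rewrite mulrC divfK.
Qed.

End NumericalRange.

(** * Shifts similar to a multiple of a unitary *)

Section NearlyNormalShift.
Context {R : realType}.
Local Notation C := R[i].

(* If every product of at most n consecutive weights is within a factor 2 of
   the power of the geometric mean r, the diagonal similarity taking the shift
   to a scalar multiple of a unitary one has condition number at most 2. *)
Lemma nearly_normal_horner_le n (w : nat -> C) (p : {poly C}) (K r : R)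
    (x : 'cV[C]_n.+1) :
  (forall k, w (k + n.+1)%N = w k) -> (forall k, w k != 0) -> 0 < r ->
  r ^+ n.+1 = \prod_(l < n.+1) normc (w l) ->
  (forall k j, (j <= n)%N -> \prod_(l < j) normc (w (k + l)%N) <= 2 * r ^+ j) ->
  (forall z, numrange (cshift n w) z -> normc p.[z] <= K) ->
  sqn _ (horner_mx (cshift n w) p *m x) <= 4 * K ^+ 2 * sqn _ x.
Proof.
move=> wn w0 r0 rn hr hK.
pose W := \prod_(l < n.+1) w l.
pose lam : C := (n.+1).-root W.
have lamE : lam ^+ n.+1 = W by apply: rootCK.
have lam_r : normc lam = r.
  apply/eqP; rewrite -(@eqrXn2 _ n.+1) ?normc_ge0 ?(ltW r0) //.
  by rewrite -normcX lamE rn /W normc_prod.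
pose Pw k := \prod_(l < k) w l.
have Pw0 k : Pw k != 0 by apply/prodf_neq0.
have PwS k : Pw k.+1 = Pw k * w k by rewrite /Pw big_ord_recr.
have PwD k : Pw (k + n.+1)%N = Pw k * W.
  elim: k => [|k IH]; first by rewrite /Pw big_ord0 mul1r.
  by rewrite addSn PwS IH PwS wn; ring.
(* This solves [w_k s_(k+1) = lam s_k], hence conjugates the shift to [lam] times a cyclic
   permutation; [lam^(n+1) = W] makes it periodic. *)
pose s k := lam ^+ k / Pw k.
have sS k : w k * s k.+1 = lam * s k.
  by rewrite /s PwS exprS; field; rewrite Pw0 w0.
have W0 : W != 0 by exact: Pw0.
have sP k : s (k + n.+1)%N = s k.
  by rewrite /s PwD exprD lamE; field; rewrite Pw0 W0.
have lam0 : lam != 0.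
  by apply/eqP => l0; move: W0; rewrite -lamE l0 expr0n eqxx.
have s0 k : s k != 0 by rewrite mulf_neq0 ?expf_neq0 ?invr_eq0.
have s00 : s 0%N = 1 by rewrite /s /Pw big_ord0 expr0 divr1.
have sle a j : (j <= n)%N -> normc (s a) <= 2 * normc (s (a + j)%N).
  move=> jn.
  have e : s a * lam ^+ j = s (a + j)%N * \prod_(l < j) w (a + l)%N.
    elim: (j) => [|i IH]; first by rewrite big_ord0 addn0 expr0.
    rewrite exprSr mulrA IH big_ord_recr addnS /= [RHS]mulrCA.
    by rewrite [s _ * w _]mulrC sS; ring.
  have rj : 0 < r ^+ j by exact: exprn_gt0.
  rewrite -(ler_pM2r rj) -[in leLHS]lam_r -normcX -normcM e normcM normc_prod.
  by rewrite mulrAC [leRHS]mulrC ler_wpM2l ?normc_ge0 // hr.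
(* Going forward from [a] to [b], around the cycle if [b < a], takes at most [n] steps. *)
have sab (a b : 'I_n.+1) : normc (s a) <= 2 * normc (s b).
  case: (leqP a b) => [ab|ba].
    have := sle a (b - a)%N; rewrite subnKC //; apply.
    by rewrite (leq_trans (leq_subr _ _)) // -ltnS.
  have := sle a (b + n.+1 - a)%N; rewrite subnKC; last first.
    by rewrite (leq_trans (ltnW (ltn_ord a))) // leq_addl.
  by rewrite sP; apply; rewrite leq_subLR addnS -addSn leq_add2r.
set Cm := cshift n w; pose V := cshift n (fun=> 1 : C).
pose Sd := diag_mx (\row_(i < n.+1) s i).
pose q := p \Po (lam *: 'X).
have CS : Cm *m Sd = Sd *m horner_mx V (lam *: 'X).
  rewrite horner_mxZ horner_mx_X; apply/matrixP => i j.
  rewrite mul_mx_diag mul_diag_mx !mxE.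
  case: eqP => [->|_]; last by rewrite !mulr0n mul0r !mulr0.
  by rewrite !mulr1n mulr1 /= periodic_modn // sS mulrC.
(* [lam z] is an eigenvalue of the shift, with eigenvector [s_i z^i], so it lies in the numerical
   range. *)
have qb z : z ^+ n.+1 = 1 -> normc q.[z] <= K.
  move=> z1; rewrite horner_comp hornerZ hornerX; apply: hK.
  pose y : 'cV[C]_n.+1 := \col_i (s i * z ^+ i).
  have y0 : 0 < sqn _ y.
    rewrite lt_neqAle sqn_ge0 andbT eq_sym; apply/eqP => /sqn_eq0 /colP /(_ 0).
    by rewrite !mxE s00 expr0 mulr1 => /eqP; rewrite oner_eq0.
  have Cy : Cm *m y = (lam * z) *: y.
    apply/colP => i; rewrite cshiftE !mxE /=.
    have -> : s (i.+1 %% n.+1)%N = s i.+1 by rewrite periodic_modn.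
    have -> : z ^+ (i.+1 %% n.+1) = z ^+ i.+1 by rewrite expr_mod.
    by rewrite mulrA sS exprS; ring.
  apply: (numrange_scale _ _ y) => //.
  by rewrite /qform -mulmxA Cy -scalemxAr mxE sqnE mulrC.
have K0 : 0 <= K by apply: le_trans (normc_ge0 _) (qb 1 (expr1n _ _)).
pose y : 'cV[C]_n.+1 := \col_i (x i 0 / s i).
have xy : x = Sd *m y.
  by apply/colP => i; rewrite mul_diag_mx !mxE mulrC divfK.
rewrite {1}xy mulmxA (horner_mx_intertwine _ _ _ _ _ _ p CS) -mulmxA.
rewrite -horner_mx_comp -/q.
pose am := [arg max_(i > ord0) normc (s (i : 'I_n.+1))]%O.
have amP i : normc (s (i : 'I_n.+1)) <= normc (s am).
  by rewrite /am; case: arg_maxP => // a _; apply.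
apply: (@le_trans _ _ (normc (s am) ^+ 2 * sqn _ (horner_mx V q *m y))).
  rewrite /sqn mulr_sumr ler_sum // => i _.
  rewrite mul_diag_mx !mxE normcM exprMn ler_wpM2r ?sqr_ge0 //.
  by rewrite ler_pXn2r ?nnegrE ?normc_ge0.
apply: (@le_trans _ _ (normc (s am) ^+ 2 * (K ^+ 2 * sqn _ y))).
  rewrite ler_wpM2l ?sqr_ge0 //; apply: unitary_horner_le qb => //.
    exact: cshift1_unitary.
  exact: cshift1_expn.
have -> : 4 * K ^+ 2 * sqn _ x = K ^+ 2 * (4 * sqn _ x) by ring.
rewrite mulrCA ler_wpM2l ?sqr_ge0 // /sqn !mulr_sumr.
apply: ler_sum => i _; rewrite !mxE.
rewrite [normc (x i 0 / s i)]normcM [normc (s i)^-1]normcV exprMn exprVn.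
rewrite mulrA [normc (s am) ^+ 2 * _]mulrC -[leLHS]mulrA [leRHS]mulrC.
rewrite ler_wpM2l ?sqr_ge0 // ler_pdivrMr ?exprn_gt0 ?normc_gt0 //.
have -> : 4 * normc (s i) ^+ 2 = (2 * normc (s i)) ^+ 2 by ring.
by rewrite ler_pXn2r ?nnegrE ?mulr_ge0 ?normc_ge0.
Qed.

End NearlyNormalShift.

(** * Test vectors on a cycle *)

Section CyclicChains.
Context {R : realType}.
Local Notation C := R[i].
Local Notation conj := (@conjc R).

Lemma reindex_shift (T : Type) (idx : T) (op : Monoid.com_law idx) n (F : 'I_n.+1 -> T) k :
  \big[op/idx]_i F i = \big[op/idx]_(l < n.+1) F (inZp (k + l)).
Proof.
pose c := (n.+1 - k %% n.+1)%N.
have ck (l : nat) : inZp (k + l + c) = inZp l :> 'I_n.+1.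
  apply: val_inj; rewrite /= /c -addnA addnC -modnDmr -addnA subnK ?modnDr //.
  by rewrite ltnW // ltn_pmod.
rewrite (reindex (fun l : 'I_n.+1 => inZp (k + l))) //=.
exists (fun i : 'I_n.+1 => inZp (i + c)) => i _.
  by rewrite inZpD ck valZpK.
by rewrite addnC inZpD [(_ + k)%N]addnC addnA ck valZpK.
Qed.

(** Reading the cycle from position [k] gives a path of [n] edges; the edge that closes it is kept
    apart. *)
Lemma chain_vector n (w z : nat -> C) k : (forall k, w (k + n.+1)%N = w k) ->
  exists2 x : 'cV[C]_n.+1, sqn _ x = \sum_(l < n.+1) normc (z l) ^+ 2 &
    qform _ (cshift n w) x x =
      \sum_(l < n) conj (z l) * (w (k + l)%N * z l.+1) +
      conj (z n) * (w (k + n)%N * z 0%N).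
Proof.
move=> wn; pose c := (n.+1 - k %% n.+1)%N.
have ck (l : nat) : ((k + l + c) %% n.+1 = l %% n.+1)%N.
  rewrite /c -addnA addnC -modnDmr -addnA subnK ?modnDr //.
  by rewrite ltnW // ltn_pmod.
pose x : 'cV[C]_n.+1 := \col_i z ((i + c) %% n.+1)%N.
have xE l : x (inZp (k + l)) 0 = z (l %% n.+1)%N.
  by rewrite mxE /= modnDml ck.
exists x.
  rewrite /sqn (reindex_shift _ _ _ _ _ k); apply: eq_bigr => l _.
  by rewrite xE modn_small.
have CxE l : (cshift n w *m x) (inZp (k + l)) 0 = w (k + l)%N * z (l.+1 %% n.+1)%N.
  rewrite cshiftE /= periodic_modn //; congr (_ * _).
  have -> : inZp ((k + l) %% n.+1).+1 = inZp (k + l.+1) :> 'I_n.+1.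
    by apply: val_inj; rewrite /= -addn1 modnDml addn1 addnS.
  exact: xE.
rewrite qformE (reindex_shift _ _ _ _ _ k) big_ord_recr /=; congr (_ + _).
  apply: eq_bigr => l _; have ln := ltn_ord l.
  have ln1 : (l < n.+1)%N by rewrite ltnW.
  by rewrite CxE xE (modn_small ln1) modn_small.
by rewrite CxE xE modnn modn_small.
Qed.

Lemma periodic_prod (T : comPzRingType) n (w : nat -> T) k : (forall k, w (k + n.+1)%N = w k) ->
  \prod_(l < n.+1) w (k + l)%N = \prod_(l < n.+1) w l.
Proof.
move=> wn; rewrite [RHS](reindex_shift _ _ _ _ _ k); apply: eq_bigr => l _.
by rewrite /= periodic_modn.
Qed.

(** A cycle of length at least 2 has zero diagonal, so a basis vector does it. *)
Lemma numrange_cshift0 n (w : nat -> C) : (0 < n)%N -> numrange (cshift n w) 0.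
Proof.
case: n => [//|n] _; pose x : 'cV[C]_n.+2 := delta_mx 0 0.
have x1 : sqn _ x = 1.
  rewrite /sqn (bigD1 0) //= big1 ?addr0 => [|i i0]; last first.
    by rewrite mxE (negPf i0) normc0 expr0n.
  by rewrite mxE !eqxx normc1 expr1n.
apply: (numrange_scale _ _ x); rewrite ?x1 ?ltr01 // mulr0 qformE big1 // => i _.
rewrite cshiftE !mxE; case: eqP => [->|_]; last by rewrite conjc0 mul0r.
have /negPf -> : inZp 1 != 0 :> 'I_n.+2 by [].
by rewrite !mulr0.
Qed.

(* The vector of balanced_chain placed along a run of j consecutive weights,
   with phases chosen so that every edge of the run contributes a positive
   multiple of e; when j = n the only remaining edge closes the cycle. *)
Lemma run_test_vector n (w : nat -> C) k j (N : R) (e : C) :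
  (forall k, w (k + n.+1)%N = w k) -> (0 < j <= n)%N -> 0 < N ->
  \prod_(l < j) normc (w (k + l)%N) = 2 * N ^+ j ->
  normc e <= 1 -> ((1 < j)%N -> normc e = 1) ->
  exists2 x : 'cV[C]_n.+1, sqn _ x <= 1 &
    qform _ (cshift n w) x x = N%:C * (e +
      (if j == n then (\prod_(l < n.+1) w l) / (4 * n%:R * N ^+ n.+1)%:C * conj e ^+ n
       else 0)).
Proof.
move=> wn /andP[j0 jn] N0 hN e1 ej.
have hw l : (l < j)%N -> w (k + l)%N != 0.
  move=> lj; apply/eqP => w0; move: hN; rewrite (bigD1 (Ordinal lj)) //= w0 normc0 mul0r.
  by move/esym/eqP; rewrite mulf_eq0 pnatr_eq0 expf_eq0 /= (gt_eqF N0) andbF.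
have [y [y0j y1 yN]] := balanced_chain j (fun l => normc (w (k + l)%N)) N
  j0 (ltW N0) (fun l _ => normc_ge0 _) hN.
pose sg l := conj (w (k + l)%N) / (normc (w (k + l)%N))%:C.
pose u l := \prod_(i < l) (e * sg i).
have sg1 l : (l < j)%N -> normc (sg l) = 1.
  move=> lj; have h := normc_gt0 _ (hw l lj).
  by rewrite /sg normcM normcV normc_conj normc_real gtr0_norm // mulfV // gt_eqF.
have uS l : u l.+1 = u l * (e * sg l) by rewrite /u big_ord_recr.
have un l : (l <= j)%N -> normc (u l) = normc e ^+ l.
  elim: l => [_|l IH lj]; first by rewrite /u big_ord0 normc1.
  by rewrite uS normcM [normc (e * _)]normcM sg1 // mulr1 IH ?(ltnW lj) // exprSr.
(* Only [u j] can have modulus below 1, and only if [j = 1]; this is why [e] may then lie inside the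
   disc. *)
have u1 l : (l < j)%N -> normc (u l) = 1.
  case: l => [_|l lj]; first by rewrite un // expr0.
  by rewrite un ?(ltnW lj) // ej ?expr1n //; apply: leq_ltn_trans lj.
pose z l : C := if (l <= j)%N then (y l)%:C * u l else 0.
have [x xn xq] := chain_vector n w z k wn; exists x.
  rewrite xn; apply: le_trans y1.
  have jn1 : (j.+1 <= n.+1)%N by [].
  rewrite [leRHS](big_ord_widen_cond _ xpredT (fun l => y l ^+ 2) jn1).
  rewrite [leRHS]big_mkcond /=; apply: ler_sum => l _.
  rewrite /z ltnS; case: ifP => [lj|_]; last by rewrite normc0 expr0n.
  rewrite normcM exprMn normc_real real_normK ?num_real // un // -exprM.
  by rewrite ler_piMr ?sqr_ge0 // exprn_ile1 ?normc_ge0.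
rewrite xq mulrDr; congr (_ + _).
  rewrite (eq_bigr (fun l : 'I_n => if (l < j)%N then
      (normc (w (k + l)%N) * (y l * y l.+1))%:C * e else 0)); last first.
    move=> l _; rewrite /z; case: (ltnP l j) => [lj|jl]; last by rewrite !mulr0.
    rewrite (ltnW lj) uS conjcM conjc_real /sg.
    have wl := hw l lj.
    have nw : (normc (w (k + l)%N))%:C != 0 :> C by rewrite fmorph_eq0 gt_eqF // normc_gt0.
    have wE : w (k + l)%N * conj (w (k + l)%N) = (normc (w (k + l)%N))%:C ^+ 2.
      by rewrite mulrC conjc_mul_norm rmorphXn.
    have uE : conj (u l) * u l = 1 by rewrite conjc_mul_norm u1 // expr1n.
    transitivity ((y l)%:C * (y l.+1)%:C * e * (conj (u l) * u l) *
        (w (k + l)%N * conj (w (k + l)%N)) / (normc (w (k + l)%N))%:C); first by ring.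
    by rewrite uE wE !rmorphM /=; field.
  rewrite -big_mkcond /= -(big_ord_widen _
    (fun l => (normc (w (k + l)%N) * (y l * y l.+1))%:C * e) jn).
  by rewrite -mulr_suml -rmorph_sum yN.
case: eqP => [jn'|jn']; last first.
  have nj : (n <= j)%N = false.
    by apply/negbTE; rewrite -ltnNge ltn_neqAle jn andbT; apply/eqP.
  by rewrite /z nj conjc0 mul0r mulr0.
subst j; rewrite /z leqnn /= conjcM conjc_real [u 0%N]big_ord0 mulr1.
have uE : conj (u n) * (2 * N ^+ n)%:C = conj e ^+ n * \prod_(l < n) w (k + l)%N.
  rewrite -hN (rmorph_prod (real_complex R)) /u (rmorph_prod (@conjc R)) /= -big_split /=.
  rewrite -[conj e ^+ n](_ : \prod_(l < n) conj e = _); last first.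
    by rewrite prodr_const card_ord.
  rewrite -big_split; apply: eq_bigr => l _ /=.
  have nw : (normc (w (k + l)%N))%:C != 0 :> C.
    by rewrite fmorph_eq0 gt_eqF // normc_gt0 // hw.
  by rewrite conjcM /sg conjcM conjcK conjc_inv conjc_real; field.
rewrite -(periodic_prod _ _ _ k wn) big_ord_recr /=.
have NR0 : N != 0 by rewrite gt_eqF.
have nR0 : n%:R != 0 :> R by rewrite pnatr_eq0 -lt0n.
have P0 : (2 * N ^+ n)%:C != 0 :> C.
  by rewrite fmorph_eq0 mulf_neq0 ?pnatr_eq0 ?expf_neq0.
set Q := \prod_(l < n) _ in uE *; set v := w _.
(* Here [1 / (2 n)] is [y 0 * y n] and [2 N^n] the modulus of the run; a factor [N] is pulled out of
   the closing term. *)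
have cE : (2 * n%:R)^-1 / (2 * N ^+ n) = N / (4 * n%:R * N ^+ n.+1) :> R.
  by rewrite exprS; field; rewrite NR0 nR0 expf_neq0.
move: uE P0 => /(canRL (mulfK _)) uE P0.
transitivity (((2 * n%:R)^-1 / (2 * N ^+ n))%:C * (conj e ^+ n * Q * v)).
  by rewrite uE // -y0j (rmorphM _ (_ * _)) (fmorphV (real_complex R)) rmorphM /=; ring.
by rewrite cE (rmorphM _ N) (fmorphV (real_complex R)) /=; ring.
Qed.

(** For [n = 1], [E] ranges over the disc and [s = 1]; for larger [n], [E] stays on the circle and
    [s] fills the hull. These are the moduli allowed in [run_test_vector]. *)
Lemma curve_cover (b : C) n : (0 < n)%N -> normc b <= (4 * n%:R)^-1 ->
  exists E : C, exists s : R, [/\ normc E <= 1, (1 < n)%N -> normc E = 1, 0 <= s <= 1 &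
    1 - (4 * n%:R * normc b ^+ 2)%:C + b = s%:C * (E + conj b * conj E ^+ n)].
Proof.
case: n => [//|[|n]] _ hb.
  have [|E E1 eE] := ellipse_cover b; first by rewrite -[4]mulr1.
  exists E, 1; rewrite ler01 lexx; split => //.
  by rewrite mulr1 mul1r expr1 -eE rmorphM /= rmorph_nat.
have [//|//|E [s [E1 s01 eE]]] := hypotrochoid_cover b n.+2.
by exists E, s; split => //; rewrite E1.
Qed.

End CyclicChains.

(** * Bounds for shifts with bounded or maximal runs *)

Section CyclicShiftBound.
Context {R : realType}.
Local Notation C := R[i].
Local Notation conj := (@conjc R).

Lemma cshiftZ n (a : C) (w : nat -> C) : a *: cshift n w = cshift n (fun k => a * w k).
Proof. by apply/matrixP => i j; rewrite !mxE mulrnAr. Qed.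

Lemma cshift_cycle n (w : nat -> C) : (forall k, w (k + n.+1)%N = w k) ->
  cshift n w ^+ n.+1 = (\prod_(l < n.+1) w l)%:M.
Proof.
move=> wn; apply/matrixP => i j.
have := cshift_powE n w (delta_mx j 0) n.+1 i wn.
rewrite -colE !mxE valZpK eqxx andbT => ->.
have -> : inZp (i + n.+1) = i by apply: val_inj; rewrite /= modnDr modn_small.
by rewrite periodic_prod // mulr_natr.
Qed.

(** The largest product of a run from [k], called [peak k], lies between 1 (empty run) and 2, so the
    weighted norm is within a factor 2 of the Euclidean one. *)
Lemma run_bounded_horner_le n (c : nat -> C) (q : {poly C}) (K : R) (x : 'cV[C]_n.+1) :
  (forall k, c (k + n.+1)%N = c k) ->
  (forall k i, (i <= n)%N -> \prod_(l < i) normc (c (k + l)%N) <= 2) ->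
  normc (\prod_(l < n.+1) c l) < 1 ->
  (forall z, normc z = 1 -> normc q.[z] <= K) ->
  sqn _ (horner_mx (cshift n c) q *m x) <= 4 * K ^+ 2 * sqn _ x.
Proof.
move=> cn c2 c1 hq.
pose run k i := \prod_(l < i) normc (c (k + l)%N).
have run0 k i : 0 <= run k i by apply: prodr_ge0 => l _; apply: normc_ge0.
have runS k i : run k i.+1 = normc (c k) * run k.+1 i.
  rewrite /run big_ord_recl addn0; congr (_ * _); apply: eq_bigr => l _.
  by rewrite /bump /= addnA addn1.
(* The shift contracts the norm sum_k |y_k / peak k|^2. *)
pose peak k := \big[Num.max/0]_(i < n.+1) run k i.
have run_peak k i : (i <= n)%N -> run k i <= peak k.
  by move=> ni; rewrite /peak (le_bigmax _ (fun i : 'I_n.+1 => run k i)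
    (Ordinal (ni : (i < n.+1)%N))).
have peak1 k : 1 <= peak k.
  by apply: le_trans (run_peak k 0%N _); rewrite // /run big_ord0.
have peak2 k : peak k <= 2.
  by apply/bigmax_leP; split=> // i _; apply: c2; rewrite -ltnS.
have peak0 k : 0 < peak k by apply: lt_le_trans (peak1 k).
have peakP k : peak (k + n.+1)%N = peak k.
  apply: eq_bigr => i _; apply: eq_bigr => l _; congr (normc _).
  by rewrite addnAC cn.
(* Prepending [c k] lengthens a run by one; if that closes the cycle, the product is below
   [1 <= peak k]. *)
have peakS k : normc (c k) * peak k.+1 <= peak k.
  have [->|ck] := eqVneq (normc (c k)) 0; first by rewrite mul0r ltW.
  have ckp : 0 < normc (c k) by rewrite lt_neqAle eq_sym ck normc_ge0.
  rewrite mulrC -ler_pdivlMr //; apply/bigmax_leP; split=> [|i _].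
    by rewrite divr_ge0 ?(ltW (peak0 k)) ?(ltW ckp).
  rewrite ler_pdivlMr // mulrC -runS.
  have := ltn_ord i; rewrite ltnS leq_eqVlt => /orP[/eqP ->|]; last exact: run_peak.
  apply: le_trans (peak1 k); apply/ltW; apply: le_lt_trans c1.
  by rewrite normc_prod /run (periodic_prod _ _ (fun l => normc (c l))) // => l; rewrite cn.
pose s (i : 'I_n.+1) := (peak i ^+ 2)^-1.
(* Coordinate [i] is read by row [i - 1], written [n + i] modulo [n + 1]. *)
pose e (i : 'I_n.+1) := s i - (normc (c (n + i)%N) / peak (n + i)%N) ^+ 2.
have s0 i : 0 <= s i by rewrite invr_ge0 sqr_ge0.
have e0 i : 0 <= e i.
  rewrite subr_ge0 /s -exprVn ler_pXn2r ?nnegrE ?divr_ge0 ?invr_ge0 ?normc_ge0 ?(ltW (peak0 _)) //.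
  rewrite ler_pdivrMr // mulrC ler_pdivlMr //.
  have := peakS (n + i)%N; have -> : (n + i).+1 = (i + n.+1)%N by rewrite addnS addnC.
  by rewrite peakP.
have hT y : wsqn _ s y - wsqn _ s (cshift n c *m y) = \sum_i e i * normc (y i 0) ^+ 2.
  rewrite [in X in _ - X]/wsqn (reindex_shift _ _ _ _ _ n) /wsqn -sumrB.
  apply: eq_bigr => i _; rewrite cshiftE normcM exprMn /e mulrBl; congr (_ - _).
  have -> : inZp (inZp (n + i) : 'I_n.+1).+1 = i.
    apply: val_inj; rewrite /= -addn1 modnDml addn1 -addSn addnC modnDr.
    by rewrite modn_small.
  rewrite /s /= !periodic_modn // expr_div_n; ring.
have K0 := normc_bound_ge0 _ _ hq.
have le4 y : sqn n.+1 y <= 4 * wsqn _ s y.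
  rewrite /sqn /wsqn mulr_sumr; apply: ler_sum => i _.
  rewrite mulrA ler_peMl ?sqr_ge0 // /s ler_pdivlMr ?exprn_gt0 // mul1r.
  have -> : 4 = 2 ^+ 2 :> R by ring.
  by rewrite ler_pXn2r ?nnegrE ?(ltW (peak0 _)).
have le1 y : wsqn _ s y <= sqn n.+1 y.
  rewrite /sqn /wsqn; apply: ler_sum => i _.
  by rewrite ler_piMl ?sqr_ge0 // /s invf_le1 ?exprn_gt0 // expr_ge1 ?(ltW (peak0 _)).
apply: le_trans (le4 _) _; rewrite -mulrA ler_wpM2l //.
apply: le_trans (_ : K ^+ 2 * wsqn _ s x <= _); last by rewrite ler_wpM2l ?sqr_ge0.
apply: (contraction_horner_le _ _ s e n.+1 (\prod_(l < n.+1) c l)) => //.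
exact: cshift_cycle.
Qed.

(** The previous bound for [T = cshift n c] is applied to [p \Po g], where [g(T)] is the shift
    itself; [g] depends on whether [j = n]. *)
Lemma expanding_horner_le n (w : nat -> C) (p : {poly C}) (K N : R) k j (x : 'cV[C]_n.+1) :
  (forall k, w (k + n.+1)%N = w k) -> (0 < j <= n)%N -> 0 < N ->
  \prod_(l < j) normc (w (k + l)%N) = 2 * N ^+ j ->
  (forall k i, (i <= n)%N -> \prod_(l < i) normc (w (k + l)%N) <= 2 * N ^+ i) ->
  normc (\prod_(l < n.+1) w l) < N ^+ n.+1 ->
  (forall z, numrange (cshift n w) z -> normc p.[z] <= K) ->
  sqn _ (horner_mx (cshift n w) p *m x) <= 4 * K ^+ 2 * sqn _ x.
Proof.
move=> wn jn N0 hj hrun hW hK.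
have n0 : (0 < n)%N by case/andP: jn => a b; apply: leq_trans b.
have NC : N%:C != 0 :> C by rewrite fmorph_eq0 gt_eqF.
have NV : normc (N%:C)^-1 = N^-1 by rewrite normcV normc_real gtr0_norm.
pose c k := (N%:C)^-1 * w k.
have TE : cshift n c = (N%:C)^-1 *: cshift n w by rewrite cshiftZ.
have cn l : c (l + n.+1)%N = c l by rewrite /c wn.
have prodc m i : \prod_(l < i) normc (c (m + l)%N) = \prod_(l < i) normc (w (m + l)%N) / N ^+ i.
  rewrite (eq_bigr (fun l : 'I_i => N^-1 * normc (w (m + l)%N))).
    by rewrite big_split /= prodr_const card_ord exprVn mulrC.
  by move=> l _; rewrite normcM NV.
have kE : \prod_(l < n.+1) c l = (\prod_(l < n.+1) w l) / N%:C ^+ n.+1.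
  by rewrite big_split /= prodr_const card_ord exprVn mulrC.
suff [g gT gW] : exists2 g : {poly C}, horner_mx (cshift n c) g = cshift n w &
    forall z, normc z = 1 -> numrange (cshift n w) g.[z].
  rewrite -gT -horner_mx_comp; apply: run_bounded_horner_le => //.
  - move=> m i ni; rewrite prodc ler_pdivrMr ?exprn_gt0 //; exact: hrun.
  - rewrite kE normcM normcV normcX normc_real gtr0_norm // ltr_pdivrMr ?exprn_gt0 //.
    by rewrite mul1r.
  - by move=> z z1; rewrite horner_comp; apply: hK; apply: gW.
have W0 := numrange_cshift0 n w n0.
have NT : N%:C *: cshift n c = cshift n w by rewrite TE scalerA mulfV // scale1r.
have [jE|jE] := eqVneq j n; last first.
  (* The closing edge misses the run, so the test vector with [e = z] gives exactly [N z]. *)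
  exists (N%:C *: 'X) => [|z z1]; first by rewrite horner_mxZ horner_mx_X.
  have [||x0 x01 x0q] := run_test_vector n w k j N z wn jn N0 hj.
  - by rewrite z1.
  - by [].
  rewrite hornerZ hornerX; move: x0q; rewrite (negPf jE) addr0 => <-.
  have := numrange_ball _ (cshift n w) x0 1 W0 x01.
  by rewrite mul1r; apply; rewrite ler01 lexx.
subst j; set W := \prod_(l < n.+1) w l in hW kE.
pose b := W / (4 * n%:R * N ^+ n.+1)%:C.
have nR : 0 < n%:R :> R by rewrite ltr0n.
have nC : n%:R != 0 :> C by rewrite pnatr_eq0 -lt0n.
have b4 : normc b <= (4 * n%:R)^-1.
  have d0 : 0 < 4 * n%:R * N ^+ n.+1 by rewrite !mulr_gt0 ?exprn_gt0.
  rewrite normcM normcV normc_real (gtr0_norm d0) ler_pdivrMr // mulrA mulVf ?mul1r ?ltW //.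
  by rewrite mulf_neq0 ?pnatr_eq0 // gt_eqF.
pose B := 4 * n%:R * normc b ^+ 2.
(* Since [T^(n+1) = 4 n b], the last term at [T] equals [B T] and restores the linear coefficient to
   1. *)
exists (N%:C *: ((1 - B%:C) *: 'X + conj b *: 'X^(n.+2))) => [|z z1].
  rewrite horner_mxZ rmorphD /= !horner_mxZ rmorphXn /= horner_mx_X -NT; congr (_ *: _).
  rewrite exprSr cshift_cycle // kE -mulmxE mul_scalar_mx scalerA -scalerDl.
  suff -> : 1 - B%:C + conj b * (W / N%:C ^+ n.+1) = 1 by rewrite scale1r.
  have -> : W / N%:C ^+ n.+1 = 4 * n%:R * b.
    rewrite /b !rmorphM rmorphXn !rmorph_nat /=; field.
    by rewrite nC expf_neq0.
  by rewrite mulrCA conjc_mul_norm /B !rmorphM !rmorph_nat /=; ring.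
have zz : z * conj z = 1 by rewrite mulrC conjc_mul_norm z1 expr1n.
(* On the circle [g(z) = N z (1 - B + beta)]. Covering is applied to [beta], and
   [z conj beta conj E^n = b conj (z E)^n] brings the point back to the curve of [b]. *)
pose beta := conj b * z ^+ n.+1.
have nbeta : normc beta = normc b by rewrite normcM normcX z1 expr1n mulr1 normc_conj.
have [|E [s [E1 En s01 eE]]] := curve_cover beta n n0; first by rewrite nbeta.
have [||x0 x01 x0q] := run_test_vector n w k n N (z * E) wn jn N0 hj.
- by rewrite normcM z1 mul1r.
- by move=> n1; rewrite normcM z1 mul1r En.
have := numrange_ball _ (cshift n w) x0 s W0 x01 s01.
rewrite x0q eqxx -/W -/b; set v := (X in numrange _ X -> _) => hv.
suff -> : (N%:C *: ((1 - B%:C) *: 'X + conj b *: 'X^(n.+2))).[z] = v by [].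
rewrite hornerZ hornerD !hornerZ hornerX hornerXn /v [RHS]mulrCA; congr (_ * _).
have -> : (1 - B%:C) * z + conj b * z ^+ n.+2 = z * (1 - B%:C + beta).
  by rewrite /beta exprS; ring.
rewrite /B -nbeta eE [LHS]mulrCA; congr (_ * _).
rewrite mulrDr; congr (_ + _).
rewrite [conj (z * E)]conjcM exprMn /beta [conj (conj b * _)]conjcM conjcK conjcX exprS.
rewrite -[RHS]mul1r -zz; ring.
Qed.

End CyclicShiftBound.

(** * The dichotomy for one cycle *)

Section CyclicShiftDichotomy.
Context {R : realType}.
Local Notation C := R[i].

Lemma nonneg_root (a : R) j : (0 < j)%N -> 0 <= a -> exists2 b : R, 0 <= b & b ^+ j = a.
Proof.
move=> j0 a0; exists (powR a j%:R^-1); first exact: powR_ge0.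
rewrite -powR_mulrn ?powR_ge0 // -powRrM mulVf ?powRr1 //.
by rewrite pnatr_eq0 -lt0n.
Qed.

(** [f (k, i)] is the rate of the run of length [i + 1] from [k]. Modulo the period there are
    finitely many runs, so if some rate exceeds [r] a largest one exists; otherwise the shift is
    nearly normal or, when [r = 0], zero. *)
Lemma cshift_horner_le n (w : nat -> C) (p : {poly C}) (K : R) (x : 'cV[C]_n.+1) :
  (forall k, w (k + n.+1)%N = w k) ->
  (forall z, numrange (cshift n w) z -> normc p.[z] <= K) ->
  sqn _ (horner_mx (cshift n w) p *m x) <= 4 * K ^+ 2 * sqn _ x.
Proof.
move=> wn hK.
pose run k i := \prod_(l < i) normc (w (k + l)%N).
have run0 k i : 0 <= run k i by apply: prodr_ge0 => l _; apply: normc_ge0.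
have runm k i : run (k %% n.+1)%N i = run k i.
  apply: (periodic_modn _ _ (fun k => run k i)) => m.
  by apply: eq_bigr => l _; rewrite addnAC wn.
have [r r0 rE] := nonneg_root (run 0 n.+1) n.+1 isT (run0 _ _).
have WE : normc (\prod_(l < n.+1) w l) = r ^+ n.+1 by rewrite rE normc_prod.
have root_ex (ki : 'I_n.+1 * 'I_n) : exists b, 0 <= b /\ b ^+ ki.2.+1 = run ki.1 ki.2.+1 / 2.
  have [|b b0 be] := @nonneg_root (run ki.1 ki.2.+1 / 2) ki.2.+1 isT.
    by rewrite divr_ge0.
  by exists b.
have [f fP] := choice root_ex.
have [hex|hex] := pselect (exists ki, r < f ki).
  case: hex => ki0 rki0.
  pose ki := [arg max_(a > ki0) f a]%O.
  have kiP a : f a <= f ki.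
    by rewrite /ki; case: arg_maxP => // b _; apply.
  set N := f ki in kiP *.
  have rN : r < N by apply: lt_le_trans rki0 (kiP _).
  have N0 : 0 < N by apply: le_lt_trans rN.
  apply: (expanding_horner_le n w p K N ki.1 ki.2.+1) => //.
  - by rewrite /= ltn_ord.
  - by have [_ e] := fP ki; rewrite /N e /run; field.
  - move=> k [|i] ni; first by rewrite big_ord0 expr0 mulr1; lra.
    pose a : 'I_n.+1 * 'I_n := (inZp k, Ordinal ni).
    have [fa0 fa] := fP a.
    have : run k i.+1 = 2 * f a ^+ i.+1 by rewrite fa /= runm; field.
    rewrite /run => ->; rewrite ler_pM2l // ler_pXn2r ?nnegrE ?(ltW N0) //.
  - by rewrite WE ltr_pXn2r ?nnegrE // ltW.
have hr k i : (i <= n)%N -> run k i <= 2 * r ^+ i.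
  case: i => [|i] ni; first by rewrite /run big_ord0 expr0 mulr1; lra.
  pose a : 'I_n.+1 * 'I_n := (inZp k, Ordinal ni).
  have [fa0 fa] := fP a.
  have -> : run k i.+1 = 2 * f a ^+ i.+1 by rewrite fa /= runm; field.
  rewrite ler_pM2l // ler_pXn2r ?nnegrE // leNgt; apply/negP => h.
  by apply: hex; exists a.
have [r00|rN0] := eqVneq r 0; last first.
  have rp : 0 < r by rewrite lt_neqAle eq_sym rN0.
  have w0 k : w k != 0.
    apply/eqP => wk; have : run k n.+1 = 0.
      by rewrite /run big_ord_recl addn0 wk normc0 mul0r.
    rewrite /run (periodic_prod _ n (fun l => normc (w l)) k) => [|l]; last by rewrite wn.
    by move/eqP; rewrite -[X in X == 0]rE expf_eq0 /= (negPf rN0).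
  exact: (nearly_normal_horner_le n w p K r).
(* For [n = 0] the only weight has modulus [r]; otherwise each weight is a run of length 1, bounded
   by [2 r]. *)
have w0 k : w k = 0.
  have e i : run i n.+1 = 0.
    rewrite /run (periodic_prod _ n (fun l => normc (w l)) i) => [|l]; rewrite ?wn //.
    by rewrite -[LHS]rE r00 expr0n.
  have [n0|n0] := posnP n.
    have := e k; rewrite /run n0 big_ord1 addn0; exact: eq0_normc.
  have := hr k 1%N n0; rewrite r00 expr1 mulr0 /run big_ord1 addn0 => h.
  by apply: eq0_normc; apply/eqP; rewrite eq_le h normc_ge0.
have C0 : cshift n w = 0 by apply/matrixP => i j; rewrite !mxE w0 mul0rn.
have W0 : numrange (cshift n w) 0.
  have x1 : sqn n.+1 (delta_mx 0 0 : 'cV[C]_n.+1) = 1.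
    rewrite /sqn (bigD1 0) //= big1 ?addr0 => [|i i0]; last first.
      by rewrite mxE (negPf i0) normc0 expr0n.
    by rewrite mxE !eqxx normc1 expr1n.
  by apply: (numrange_scale _ _ (delta_mx 0 0)); rewrite ?x1 // C0 qformE big1 ?mulr0 // => i _;
    rewrite mul0mx [X in _ * X]mxE mulr0.
have pK := hK 0 W0.
have -> : horner_mx (cshift n w) p = p.[0]%:M.
  rewrite C0; elim/poly_ind: p {hK pK} => [|p c IH].
    by rewrite rmorph0 horner0 raddf0.
  by rewrite rmorphD rmorphM /= horner_mx_X horner_mx_C mulr0 add0r hornerMXaddC mulr0 add0r.
rewrite mul_scalar_mx sqnZ ler_wpM2r ?sqn_ge0 //.
have := normc_ge0 p.[0]; nra.
Qed.

End CyclicShiftDichotomy.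

(** * Decomposition into cycles *)

Section PermutationCycles.
Context {R : realType}.
Local Notation C := R[i].
Local Open Scope sesquilinear_scope.

Lemma sum_porbit (V : nmodType) (T : finType) (s : {perm T}) x (F : T -> V) :
  \sum_(y in porbit s x) F y = \sum_(k < #|porbit s x|) F ((s ^+ k)%g x).
Proof.
rewrite (eq_bigl _ _ (porbit_traject s x)) -big_uniq ?uniq_traject_porbit //=.
rewrite (big_nth x) size_traject big_mkord; apply: eq_bigr => k _.
by rewrite nth_traject // permX.
Qed.

(** Both squared norms split over the orbits of [s], and on each orbit [M] acts as a cyclic
    shift. *)
Lemma weighted_perm_horner_le n (w : 'I_n.+1 -> C) (s : {perm 'I_n.+1})
    (M : 'M[C]_n.+1) (p : {poly C}) (K : R) (x : 'cV[C]_n.+1) :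
  (forall i j, M i j = w i *+ (s i == j)) ->
  (forall z, numrange M z -> normc p.[z] <= K) ->
  sqn _ (horner_mx M p *m x) <= 4 * K ^+ 2 * sqn _ x.
Proof.
move=> ME hK.
rewrite {2}/sqn mulr_sumr {1}/sqn !(partition_big (porbit s) xpredT) //=.
apply: ler_sum => O _.
(* The partition runs over all subsets; those that are not orbits give empty sums. *)
have [[i0 /eqP eO]|hO] := pselect (exists i, porbit s i == O); last first.
  by rewrite !big_pred0 // => i; apply/negP => h; apply: hO; exists i.
have eP i : (porbit s i == O) = (i \in porbit s i0).
  by rewrite -eO eq_porbit_mem.
rewrite -mulr_sumr !(eq_bigl _ _ eP) !sum_porbit.
have : (0 < #|porbit s i0|)%N by apply/card_gt0P; exists i0; apply: porbit_id.
have := @iter_porbit _ s i0; have := uniq_traject_porbit s i0.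
case: #|porbit s i0| => [//|m] um im _.
pose v k := (s ^+ k)%g i0.
have vE k : v k = iter k s i0 by rewrite /v permX.
have vm k : v (k + m.+1)%N = v k by rewrite !vE iterD im.
have vmod k : v (k %% m.+1)%N = v k by apply: periodic_modn.
have vS k : v k.+1 = s (v k) by rewrite !vE.
have vinj (k l : 'I_m.+1) : v k = v l -> k = l.
  move=> kl; apply: val_inj => /=.
  apply/eqP; rewrite -(nth_uniq i0 _ _ um) ?size_traject //.
  by rewrite !nth_traject // -!vE kl.
pose c k := w (v k).
have cn k : c (k + m.+1)%N = c k by rewrite /c vm.
(* [Q] reads a vector along the orbit. From [C Q = Q M] and [Q Q^* = 1] follow [Q p(M) = p(C) Q] and
   the inclusion of [W(C)] in [W(M)]. *)
pose Q : 'M[C]_(m.+1, n.+1) := \matrix_(k, j) (v k == j)%:R.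
have QE (y : 'cV[C]_n.+1) k : (Q *m y) k 0 = y (v k) 0.
  rewrite mxE (bigD1 (v k)) //= mxE eqxx mul1r big1 ?addr0 // => j jk.
  by rewrite mxE eq_sym (negPf jk) mul0r.
have QM : cshift m c *m Q = Q *m M.
  apply/matrixP => k j; rewrite !mxE (bigD1 (inZp k.+1)) //= big1 => [|l lk]; last first.
    by rewrite mxE (negPf lk) mul0r.
  rewrite (bigD1 (v k)) //= big1 => [|l lk]; last first.
    by rewrite mxE eq_sym (negPf lk) mul0r.
  by rewrite !mxE !eqxx /= ME vmod vS mul1r mulr1n mulr_natr !addr0.
have QQ : Q *m Q ^t* = 1%:M.
  apply/matrixP => k l; rewrite !mxE (bigD1 (v k)) //= big1 => [|j jk]; last first.
    by rewrite mxE eq_sym (negPf jk) mul0r.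
  rewrite !mxE eqxx mul1r addr0 eq_sym.
  have -> : (v k == v l) = (k == l) by apply/eqP/eqP => [/vinj|->].
  by case: eqP => _; rewrite ?rmorph1 ?rmorph0.
have := cshift_horner_le m c p K (Q *m x) cn.
rewrite mulmxA (horner_mx_intertwine _ _ _ _ _ _ p QM) -mulmxA.
rewrite /sqn (eq_bigr (fun k : 'I_m.+1 => normc ((horner_mx M p *m x) (v k) 0) ^+ 2)); last first.
  by move=> k _; rewrite QE.
rewrite [X in _ -> _ <= _ * X](eq_bigr (fun k : 'I_m.+1 => normc ((Q *m x) k 0) ^+ 2)); last first.
  by move=> k _; rewrite QE.
apply => z [xi /= xi1 <-]; apply: hK.
exists (Q ^t* *m xi) => /=.
  rewrite trmx_mul map_mxM trmxCK -mulmxA (mulmxA Q) QQ mul1mx //.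
rewrite trmx_mul map_mxM trmxCK -!mulmxA (mulmxA Q) -QM -!mulmxA (mulmxA Q) QQ.
by rewrite mul1mx.
Qed.

End PermutationCycles.

(** * Attainment of the maximum *)

Section Extremum.
Context {R : realType}.
Local Notation C := R[i].
Local Notation conj := (@conjc R).

(** Stated by real and imaginary parts because compactness is used in a real space. *)
Definition ccontinuous (T : topologicalType) (g : T -> C) :=
  continuous (fun t => complex.Re (g t)) /\ continuous (fun t => complex.Im (g t)).

Lemma ccontinuous_cst (T : topologicalType) (a : C) : ccontinuous T (fun=> a).
Proof. by split=> t; apply: cvg_cst. Qed.

Lemma ccontinuousD (T : topologicalType) (f g : T -> C) :
  ccontinuous T f -> ccontinuous T g -> ccontinuous T (fun t => f t + g t).
Proof.
move=> [f1 f2] [g1 g2]; split=> t.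
  under [X in continuous_at _ X]funext do rewrite raddfD.
  exact: (cvgD (f1 t) (g1 t)).
under [X in continuous_at _ X]funext do rewrite raddfD.
exact: (cvgD (f2 t) (g2 t)).
Qed.

Lemma ccontinuousM (T : topologicalType) (f g : T -> C) :
  ccontinuous T f -> ccontinuous T g -> ccontinuous T (fun t => f t * g t).
Proof.
move=> [f1 f2] [g1 g2]; split=> t.
  have -> : (fun t => complex.Re (f t * g t)) = (fun t => complex.Re (f t) * complex.Re (g t) -
      complex.Im (f t) * complex.Im (g t)).
    by apply/funext => u; case: (f u) (g u) => a b [c d].
  exact: (cvgB (cvgM (f1 t) (g1 t)) (cvgM (f2 t) (g2 t))).
have -> : (fun t => complex.Im (f t * g t)) = (fun t => complex.Re (f t) * complex.Im (g t) +
    complex.Im (f t) * complex.Re (g t)).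
  by apply/funext => u; case: (f u) (g u) => a b [c d].
exact: (cvgD (cvgM (f1 t) (g2 t)) (cvgM (f2 t) (g1 t))).
Qed.

Lemma ccontinuous_conj (T : topologicalType) (f : T -> C) :
  ccontinuous T f -> ccontinuous T (fun t => conj (f t)).
Proof.
move=> [f1 f2]; split=> t.
  have -> : (fun t => complex.Re (conj (f t))) = (fun t => complex.Re (f t)).
    by apply/funext => u; case: (f u).
  exact: f1.
have -> : (fun t => complex.Im (conj (f t))) = (fun t => - complex.Im (f t)).
  by apply/funext => u; case: (f u).
exact: (cvgN (f2 t)).
Qed.

Lemma ccontinuous_sum (T : topologicalType) (I : Type) (r : seq I) (f : I -> T -> C) :
  (forall i, ccontinuous T (f i)) -> ccontinuous T (fun t => \sum_(i <- r) f i t).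
Proof.
move=> hf; elim: r => [|i r IH].
  have -> : (fun t => \sum_(i <- [::]) f i t) = (fun=> 0).
    by apply/funext => t; rewrite big_nil.
  exact: ccontinuous_cst.
have -> : (fun t => \sum_(j <- i :: r) f j t) = (fun t => f i t + \sum_(j <- r) f j t).
  by apply/funext => t; rewrite big_cons.
exact: ccontinuousD.
Qed.

Lemma ccontinuous_horner (T : topologicalType) (p : {poly C}) (f : T -> C) :
  ccontinuous T f -> ccontinuous T (fun t => p.[f t]).
Proof.
move=> hf; elim/poly_ind: p => [|p c IH].
  have -> : (fun t => (0 : {poly C}).[f t]) = (fun=> 0).
    by apply/funext => t; rewrite horner0.
  exact: ccontinuous_cst.
have -> : (fun t => (p * 'X + c%:P).[f t]) = (fun t => p.[f t] * f t + c).
  by apply/funext => t; rewrite hornerMXaddC.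
by apply: ccontinuousD; [exact: ccontinuousM | exact: ccontinuous_cst].
Qed.

(** The numerical range is the continuous image of the unit sphere of a real space of twice the
    dimension, which is closed in the compact cube [[-1, 1]^(2n+2)]. *)
Lemma numrange_max n (M : 'M[C]_n.+1) (p : {poly C}) :
  exists2 z0 : C, numrange M z0 &
    forall z, numrange M z -> normc p.[z] <= normc p.[z0].
Proof.
pose T := 'rV[R]_(n.+1 + n.+1).
pose vec (u : T) : 'cV[C]_n.+1 := \col_i (u 0 (lshift _ i) +i* u 0 (rshift _ i))%C.
have vc i : ccontinuous T (fun u => vec u i 0).
  split=> u.
    have -> : (fun u => complex.Re (vec u i 0)) = (fun u : T => u 0 (lshift _ i)).
      by apply/funext => t; rewrite mxE.
    exact: coord_continuous.
  have -> : (fun u => complex.Im (vec u i 0)) = (fun u : T => u 0 (rshift _ i)).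
    by apply/funext => t; rewrite mxE.
  exact: coord_continuous.
have qc B : ccontinuous T (fun u => qform _ B (vec u) (vec u)).
  have -> : (fun u => qform _ B (vec u) (vec u)) =
      (fun u => \sum_i conj (vec u i 0) * \sum_j B i j * vec u j 0).
    by apply/funext => u; rewrite qformE; apply: eq_bigr => i _; rewrite [(B *m _) _ _]mxE.
  apply: ccontinuous_sum => i; apply: ccontinuousM; first exact: ccontinuous_conj.
  by apply: ccontinuous_sum => j; apply: ccontinuousM => //; apply: ccontinuous_cst.
pose N (u : T) : R := \sum_k u 0 k ^+ 2.
have NE u : sqn _ (vec u) = N u.
  rewrite /N big_split_ord /= -big_split; apply: eq_bigr => i _.
  by rewrite mxE sqr_normcE.
pose F (u : T) : R := complex.Re p.[qform _ M (vec u) (vec u)] ^+ 2 +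
  complex.Im p.[qform _ M (vec u) (vec u)] ^+ 2.
have [rc ic] := ccontinuous_horner T p _ (qc M).
have Fc : continuous F.
  move=> u; exact: (cvgD (cvgM (rc u) (rc u)) (cvgM (ic u) (ic u))).
have Nc : continuous N.
  have -> : N = fun u => complex.Re (qform _ 1%:M (vec u) (vec u)).
    by apply/funext => u; rewrite qform1 NE.
  by have [] := qc 1%:M.
pose A : set T := [set u | N u = 1]%classic.
have cA : compact A.
  have bc := @rV_compact R (n.+1 + n.+1) (fun=> `[(-1 : R), 1]%classic)
    (fun=> @segment_compact R (-1) 1).
  apply: subclosed_compact bc _ => [|u uA i].
    have -> : A = (N @^-1` [set 1])%classic by [].
    by apply: (preimage_closed _ (@closed_eq R 1)) => ? _; exact: Nc.
  rewrite /= in_itv /= -ler_norml -(@expr_le1 _ 2) // real_normK ?num_real //.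
  rewrite -[leRHS]uA /N (bigD1 i) //= lerDl sumr_ge0 // => k _; exact: sqr_ge0.
have A0 : (A !=set0)%classic.
  exists (delta_mx 0 0); rewrite /A /= /N (bigD1 0) //= big1 ?addr0 => [|i i0].
    by rewrite mxE !eqxx expr1n.
  by rewrite mxE (negPf i0) andbF expr0n.
have [c cA1 cmax] := @derive.EVT_max_rV R _ F A A0 cA (continuous_subspaceT Fc).
exists (qform _ M (vec c) (vec c)).
  apply: numrangeE; rewrite NE; by move: cA1; rewrite inE.
move=> z [x /= x1 <-]; rewrite -/(qform _ M x x).
rewrite -(@ler_pXn2r _ 2) ?nnegrE ?normc_ge0 // !sqr_normcE.
pose u : T := row_mx (\row_i complex.Re (x i 0)) (\row_i complex.Im (x i 0)).
have xu : x = vec u.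
  apply/colP => i; rewrite mxE row_mxEl row_mxEr !mxE.
  by case: (x i 0).
rewrite xu; apply: (cmax u); rewrite inE /A /= -NE -xu.
by apply: complexI; rewrite -sqnE x1 mxE.
Qed.

End Extremum.

(** * Operator norm, translation and conclusion *)

Section Main.
Context {R : realType}.
Local Notation C := R[i].

Lemma opnorm2_le n (A : 'M[C]_n.+1) (B : R) : 0 <= B ->
  (forall x, sqn _ (A *m x) <= B ^+ 2 * sqn _ x) -> opnorm2 A <= B.
Proof.
move=> B0 h; apply: ge_sup; first by have [] := opnorm2_has_sup A.
move=> _ [x /= x1 <-].
have s1 : sqn _ x = 1.
  by rewrite -[RHS](expr1n _ 2) -x1 /norm2 sqr_sqrtr // sqn_ge0.
rewrite -(@ler_pXn2r _ 2) ?nnegrE ?sqrtr_ge0 //.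
by rewrite /norm2 sqr_sqrtr ?sqn_ge0 //; have := h x; rewrite s1 mulr1.
Qed.

Lemma numrange_translate n (M : 'M[C]_n) (a z : C) :
  numrange M z -> numrange (a%:M + M) (a + z).
Proof.
move=> [x /= x1 <-]; exists x => //.
rewrite mulmxDr mulmxDl mxE mul_mx_scalar -scalemxAl x1; congr (_ + _).
by rewrite !mxE mulr1.
Qed.

End Main.

Theorem mainTheorem3 (R : realType) (n : nat) (a : R[i])
    (D P M : 'M[R[i]]_n.+1)
    (hD : is_diag_mx D) (hP : is_perm_mx P)
    (hM : M = a%:M + D *m P \/ M = a%:M + P *m D)
    (p : {poly R[i]}) :
  exists z0 : R[i],
    [/\ numrange M z0,
        forall z : R[i], numrange M z ->
          Normc.normc p.[z] <= Normc.normc p.[z0]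
      & opnorm2 (horner_mx M p) <= 2 * Normc.normc p.[z0]].
Proof.
have [z0 Wz0 maxz0] := numrange_max n M p.
exists z0; split=> //.
case/is_perm_mxP: hP => s Ps; case/diag_mxP: hD => d Dd.
(* Both products are weighted permutation matrices; in [P *m D] row [i] carries the diagonal entry
   of index [s i]. *)
have [w [N NE MN]] : exists w : 'I_n.+1 -> R[i], exists2 N : 'M[R[i]]_n.+1,
    forall i j, N i j = w i *+ (s i == j) & M = a%:M + N.
  case: hM => ->.
    exists (fun i => d 0 i), (D *m P) => // i j.
    by rewrite Dd mul_diag_mx !mxE Ps !mxE mulr_natr.
  exists (fun i => d 0 (s i)), (P *m D) => // i j.
  rewrite Dd mul_mx_diag !mxE Ps !mxE mulr_natl.
  by case: eqP => [->|].
(* The translation by [a] is moved from the matrix into the polynomial. *)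
pose g : {poly R[i]} := a%:P + 'X.
have Mg : horner_mx M p = horner_mx N (p \Po g).
  by rewrite horner_mx_comp rmorphD /= horner_mx_X horner_mx_C -MN.
apply: opnorm2_le => [|x]; first by rewrite mulr_ge0 ?normc_ge0.
rewrite Mg exprMn -natrX.
apply: (weighted_perm_horner_le n w s) => // z Nz.
rewrite horner_comp !hornerE; apply: maxz0; rewrite MN.
exact: numrange_translate.
Qed.
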